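(* Let $H$ be a bialgebra over a field $K$, let $A$ be an $H$-module-coalgebra with structure map $\lambda$, and let $\Lambda_t=\sum_{i=0}^\infty\lambda_it^i$ be a deformation of $A$ as an $H$-module-coalgebra. Then the infinitesimal $\lambda_1$ is a $1$-cocycle in $\mathcal{F}^1_{mc}(A)$ whose cohomology class in $H^1(\mathcal{F}^\bullet_{mc}(A))$ is determined by the equivalence class of $\Lambda_t$ (equivalent deformations have cohomologous infinitesimals). Moreover: (1) If $H^2_c(A,A)$ and $H^1(\mathcal{F}^\bullet_{mc}(A))$ are both trivial, then $A$ is rigid, i.e. every deformation of $A$ is equivalent to the trivial deformation $\Lambda_t=\lambda$. (2) If $H^2(\mathcal{F}^\bullet_{mc}(A))$ is trivial, then every $1$-cocycle in $\mathcal{F}^1_{mc}(A)$ is the infinitesimal of some deformation of $A$.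
   Context: Fix a field $K$; $\otimes$ and $\mathrm{Hom}$ are over $K$. $(H,\mu_H,\Delta_H)$ is a $K$-bialgebra and $(A,\Delta_A)$ a (coassociative) coalgebra. Sweedler notation: $\Delta_H(x)=\sum_{(x)}x_{(1)}\otimes x_{(2)}$, $\Delta_A(a)=\sum_{(a)}a_{(1)}\otimes a_{(2)}$. $\mathrm{End}(A)$ is the algebra of linear endomorphisms of $A$. An $H$-module-coalgebra structure on $A$ is an $H$-module structure $\lambda\in\mathrm{Hom}(H,\mathrm{End}(A))$ (so $\lambda(xy)=\lambda(x)\circ\lambda(y)$) with $\Delta_A(\lambda(x)(a))=\sum_{(a)(x)}\lambda(x_{(1)})(a_{(1)})\otimes\lambda(x_{(2)})(a_{(2)})$ for $x\in H$, $a\in A$. A deformation of $A$ is a power series $\Lambda_t=\sum_{i\ge0}\lambda_it^i$ with $\lambda_0=\lambda$, each $\lambda_i\in\mathrm{Hom}(H,\mathrm{End}(A))$, satisfying $\Lambda_t(xy)=\Lambda_t(x)\circ\Lambda_t(y)$ and $\Delta_A(\Lambda_t(x)(a))=\sum_{(a)(x)}\Lambda_t(x_{(1)})(a_{(1)})\otimes\Lambda_t(x_{(2)})(a_{(2)})$ for all $x,y\in H$, $a\in A$ (maps extended linearly to power series). Its infinitesimal is $\lambda_1$. A formal automorphism of $A$ is a power series $\Phi_t=\sum_{i\ge0}\phi_it^i$ with $\phi_0=\mathrm{Id}_A$, each $\phi_i\in\mathrm{End}(A)$, and $\Delta_A\circ\Phi_t=\Phi_t^{\otimes2}\circ\Delta_A$.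 Deformations $\Lambda_t,\overline{\Lambda}_t$ are equivalent if $\overline{\Lambda}_t=\Phi_t^{-1}\Lambda_t\Phi_t$ for some formal automorphism $\Phi_t$, where $(\phi_i\lambda_j\phi_k)(x)=\phi_i\circ\lambda_j(x)\circ\phi_k$. Cochain complex $\mathcal{F}^\bullet_{mc}(A)$: $\mathcal{F}^0_{mc}(A)=\mathrm{Coder}(A)$, the linear maps $\varphi:A\to A$ with $\Delta_A\circ\varphi=(\mathrm{Id}_A\otimes\varphi+\varphi\otimes\mathrm{Id}_A)\circ\Delta_A$; $\mathcal{F}^1_{mc}(A)=\mathrm{Hom}(H,\mathrm{End}(A))$; for $n\ge2$, $\mathcal{F}^n_{mc}(A)=\mathrm{Hom}(H^{\otimes n},\mathrm{End}(A))\oplus\mathrm{Hom}(H,\mathrm{Hom}(A,A^{\otimes n}))$. Differentials: $(d^0_{mc}\varphi)(x)=\lambda(x)\circ\varphi-\varphi\circ\lambda(x)$; for $n\ge1$, $d^n_{mc}(\varphi_0;\varphi_1)=(d^n_{mc,0}\varphi_0;d^n_{mc,1}\varphi_1)$ (for $n=1$, $\varphi_0=\varphi_1=\varphi$), where $$(d^n_{mc,0}\varphi_0)(x_1\otimes\cdots\otimes x_{n+1})=\lambda(x_1)\circ\varphi_0(x_2\otimes\cdots\otimes x_{n+1})+\sum_{i=1}^n(-1)^i\varphi_0(x_1\otimes\cdots\otimes x_ix_{i+1}\otimes\cdots\otimes x_{n+1})+(-1)^{n+1}\varphi_0(x_1\otimes\cdots\otimes x_n)\circ\lambda(x_{n+1}),$$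 $$(d^n_{mc,1}\varphi_1)(x)(a)=\sum_{(a)(x)}\lambda(x_{(1)})(a_{(1)})\otimes\varphi_1(x_{(2)})(a_{(2)})+\sum_{i=1}^n(-1)^i(\mathrm{Id}_{A^{\otimes(i-1)}}\otimes\Delta_A\otimes\mathrm{Id}_{A^{\otimes(n-i)}})(\varphi_1(x)(a))+(-1)^{n+1}\sum_{(a)(x)}\varphi_1(x_{(1)})(a_{(1)})\otimes\lambda(x_{(2)})(a_{(2)}).$$ Hochschild coalgebra cohomology $H^\bullet_c(A,A)$: the cohomology of the complex $C^0_c(A,A)=0$, $C^n_c(A,A)=\mathrm{Hom}(A,A^{\otimes n})$ for $n\ge1$, with differential $$\delta_c\sigma=(\mathrm{Id}_A\otimes\sigma)\circ\Delta_A+\sum_{i=1}^n(-1)^i(\mathrm{Id}_{A^{\otimes(i-1)}}\otimes\Delta_A\otimes\mathrm{Id}_{A^{\otimes(n-i)}})\circ\sigma+(-1)^{n+1}(\sigma\otimes\mathrm{Id}_A)\circ\Delta_A.$$ *)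

(* Defs.v *)
From HB Require Import structures.
From mathcomp Require Import all_boot all_algebra.
From mathcomp Require Import finmap boolp functions.
From mathcomp.multinomials Require Import monalg.

Set Implicit Arguments.
Unset Strict Implicit.
Unset Printing Implicit Defensive.

Import GRing.Theory.
Local Open Scope quotient_scope.
Local Open Scope ring_scope.

(* Hom(V, W) is the type {linear V -> W}, made into a K-vector space as a     *)
(* subspace of the space of all functions V -> W.                             *)
Section LinearMaps.
Variables (K : fieldType) (V W : lmodType K).

Definition linear_pred : {pred V -> W} := fun f => `[< linear f >].

Lemma linear_map_pred (f : {linear V -> W}) : linear_pred f.
Proof. by apply/asboolP => c x y; rewrite linearP. Qed.

Lemma linear_map_subproof (f : V -> W) (fP : linear_pred f) : linear f.
Proof. exact/asboolP. Qed.

Definition linear_map (f : V -> W) (fP : linear_pred f) : {linear V -> W} :=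
  HB.pack_for {linear V -> W} f
    (GRing.isLinear.Build K V W _ f (linear_map_subproof fP)).

Lemma linear_mapK (f : {linear V -> W}) : linear_map (linear_map_pred f) = f.
Proof.
suff pf (g : V -> W) (c c' : GRing.Linear.axioms_ *:%R g) :
    GRing.Linear.Pack c = GRing.Linear.Pack c'.
  by case: f => f c; apply: pf.
case: c c' => [[a] [b]] [[a'] [b']].
by rewrite (Prop_irrelevance a a') (Prop_irrelevance b b').
Qed.

Lemma linear_map_rect (P : {linear V -> W} -> Type) :
  (forall f fP, P (@linear_map f fP)) -> forall f, P f.
Proof. by move=> Pf f; rewrite -(linear_mapK f). Qed.

HB.instance Definition _ := @isSub.Build (V -> W) linear_pred {linear V -> W}
  (@GRing.Linear.sort _ _ _ _) linear_map linear_map_rect (fun _ _ => erefl).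
HB.instance Definition _ := [Choice of {linear V -> W} by <:].

Lemma linear_submod_closed : submod_closed linear_pred.
Proof.
split=> [|c f g /asboolP lf /asboolP lg]; apply/asboolP => a x y.
  by rewrite /GRing.zero /= scaler0 addr0.
rewrite !(addrfctE, scalrfctE) lf lg !scalerDr !scalerA mulrC.
by rewrite addrACA.
Qed.
HB.instance Definition _ :=
  GRing.isSubmodClosed.Build K (V -> W) linear_pred linear_submod_closed.
HB.instance Definition _ := [SubChoice_isSubLmodule of {linear V -> W} by <:].

Lemma linear_mapP (f g : {linear V -> W}) : f =1 g -> f = g.
Proof. by move=> fg; apply: val_inj; apply/funext. Qed.

Lemma linear_mapD (f g : {linear V -> W}) x :
  (f + g : {linear V -> W}) x = f x + g x.
Proof. by []. Qed.

Lemma linear_mapN (f : {linear V -> W}) x : (- f : {linear V -> W}) x = - f x.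
Proof. by []. Qed.

Lemma linear_mapZ c (f : {linear V -> W}) x :
  (c *: f : {linear V -> W}) x = c *: f x.
Proof. by []. Qed.

Lemma linear_map0 x : (0 : {linear V -> W}) x = 0.
Proof. by []. Qed.

Lemma linear_map_sum I (r : seq I) P (F : I -> {linear V -> W}) x :
  (\sum_(i <- r | P i) F i : {linear V -> W}) x = \sum_(i <- r | P i) F i x.
Proof. by elim/big_rec2: _ => // i y1 y2 _ <-. Qed.

End LinearMaps.

Section LinearConstructions.
Variables (K : fieldType) (U V W : lmodType K).

Definition lin (f : V -> W) (fP : linear f) : {linear V -> W} :=
  linear_map (introT (asboolP _) fP).

Definition lcomp (f : {linear V -> W}) (g : {linear U -> V}) :
  {linear U -> W} := f \o g.

Lemma lcompE f g x : lcomp f g x = f (g x).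
Proof. by []. Qed.

Definition is_bilinear (F : V -> W -> U) : Prop :=
  (forall w, linear (F^~ w)) /\ (forall v, linear (F v)).

End LinearConstructions.

Definition lid (K : fieldType) (V : lmodType K) : {linear V -> V} := idfun.
Arguments lid {K} V.

Notation "f \ol g" := (lcomp f g) (at level 40, left associativity) :
  ring_scope.

(* The tensor product of V and W over K: the free vector space on V * W       *)
(* modulo the smallest subspace containing the bilinearity relators.          *)
Section Tensor.
Variables (K : fieldType) (V W : lmodType K).
Local Notation FM := {malg K[(V * W)%type]}.
Implicit Types g : FM.

Definition bilinear_relator g : Prop :=
  (exists c v v' w,
     g = << (c *: v + v', w) >> - (c *: << (v, w) >> + << (v', w) >>)) \/
  (exists c v w w',
     g = << (v, c *: w + w') >> - (c *: << (v, w) >> + << (v, w') >>)).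

Definition tensor_null : {pred FM} := fun g =>
  `[< forall S : {pred FM}, submod_closed S ->
        (forall r, bilinear_relator r -> r \in S) -> g \in S >].

Lemma tensor_null_submod : submod_closed tensor_null.
Proof.
split=> [|c g h /asboolP Ig /asboolP Ih]; apply/asboolP => S cS rS.
  by case: cS.
by case: (cS) => _; apply; [apply: Ig|apply: Ih].
Qed.
HB.instance Definition _ :=
  GRing.isSubmodClosed.Build K FM tensor_null tensor_null_submod.

Definition tensor := Quotient.quot tensor_null.
HB.instance Definition _ := GRing.Zmodule.on tensor.
HB.instance Definition _ := EqQuotient.on tensor.

Lemma tensor_eqE g h : (\pi_tensor g == \pi_tensor h) = (g - h \in tensor_null).
Proof. by rewrite -Quotient.idealrBE. Qed.

Definition tensor_scale c (t : tensor) : tensor := \pi_tensor (c *: repr t).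

Lemma tensor_scale_pi c g : tensor_scale c (\pi_tensor g) = \pi_tensor (c *: g).
Proof.
apply/eqP; rewrite tensor_eqE -scalerBr rpredZ // -tensor_eqE.
by rewrite reprK.
Qed.

Lemma tensor_piD g h : \pi_tensor (g + h) = \pi_tensor g + \pi_tensor h.
Proof. by rewrite piE. Qed.

Lemma tensor_scaleA a b t :
  tensor_scale a (tensor_scale b t) = tensor_scale (a * b) t.
Proof. by rewrite [in RHS]/tensor_scale -scalerA -tensor_scale_pi. Qed.

Lemma tensor_scale1 : left_id 1 tensor_scale.
Proof. by move=> t; rewrite /tensor_scale scale1r reprK. Qed.

Lemma tensor_scaleDr : right_distributive tensor_scale +%R.
Proof.
move=> c t u; rewrite -[t]reprK -[u]reprK -tensor_piD !tensor_scale_pi.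
by rewrite scalerDr tensor_piD.
Qed.

Lemma tensor_scaleDl t : {morph tensor_scale^~ t : a b / a + b}.
Proof. by move=> a b; rewrite /= /tensor_scale scalerDl tensor_piD. Qed.

HB.instance Definition _ := GRing.Zmodule_isLmodule.Build K tensor
  tensor_scaleA tensor_scale1 tensor_scaleDr tensor_scaleDl.

Lemma tensor_pi_linear : linear \pi_tensor.
Proof. by move=> c g h; rewrite tensor_piD -tensor_scale_pi. Qed.
HB.instance Definition _ :=
  GRing.isLinear.Build K FM tensor _ \pi_tensor tensor_pi_linear.

End Tensor.

HB.lock Definition tens (K : fieldType) (V W : lmodType K) (v : V) (w : W) :
  tensor V W := \pi_(tensor V W) << (v, w) >>.

Section TensorTheory.
Variables (K : fieldType) (V W : lmodType K).
Local Notation FM := {malg K[(V * W)%type]}.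
Local Notation tensor := (tensor V W).
Local Notation tens := (@tens K V W).
Implicit Types g : FM.

Lemma tens_linearl w : linear (tens^~ w).
Proof.
move=> c v v'; rewrite tens.unlock -linearP; apply/eqP; rewrite tensor_eqE.
by apply/asboolP => S _; apply; left; exists c, v, v', w.
Qed.

Lemma tens_linearr v : linear (tens v).
Proof.
move=> c w w'; rewrite tens.unlock -linearP; apply/eqP; rewrite tensor_eqE.
by apply/asboolP => S _; apply; right; exists c, v, w, w'.
Qed.

Lemma tensor_ind (P : tensor -> Prop) :
  (forall v w, P (tens v w)) -> (forall t u, P t -> P u -> P (t + u)) ->
  forall t, P t.
Proof.
move=> P1 PD t; rewrite -[t]reprK [repr t]monalgE linear_sum.
elim/big_ind: _ => [||[v w] _] //.
  by rewrite -(linear0 (lin (tens_linearr 0))); apply: P1.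
have -> : << (repr t)@_(v, w) *g (v, w) >>
            = (repr t)@_(v, w) *: << (v, w) >> :> FM.
  apply/malgP => p; rewrite mcoeffZ !mcoeffU.
  by case: eqP; rewrite ?mulr1 ?mulr0.
rewrite linearZ /=.
have -> : \pi_tensor << (v, w) >> = tens v w by rewrite tens.unlock.
have := linearZZ (lin (tens_linearr v)) (repr t)@_(v, w) w => /= <-.
exact: P1.
Qed.

End TensorTheory.

Definition free_ext (K : fieldType) (V W U : lmodType K) (F : V -> W -> U)
  (g : {malg K[(V * W)%type]}) : U := \sum_(p <- msupp g) g@_p *: F p.1 p.2.

(* tsum F t is the sum of the F v_i w_i (weighted by scalars) over a chosen   *)
(* representation of t as a linear combination of elementary tensors. It does *)
(* not depend on the choice when F is bilinear (tsum_tens, tsum_linear), and  *)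
(* is only used in that case.                                                 *)
HB.lock Definition tsum (K : fieldType) (V W U : lmodType K) (F : V -> W -> U)
  (t : tensor V W) : U := free_ext F (repr t).

Section Lift.
Variables (K : fieldType) (V W U : lmodType K).
Local Notation FM := {malg K[(V * W)%type]}.
Local Notation tensor := (tensor V W).
Implicit Types (F : V -> W -> U) (g : FM).

Lemma free_ext_linear F : linear (free_ext F).
Proof.
have E (d : {fset (V * W)%type}) g : (msupp g `<=` d)%fset ->
    free_ext F g = \sum_(p <- d) g@_p *: F p.1 p.2.
  move=> sgd; rewrite /free_ext; apply: big_fset_incl => // p _.
  by rewrite -mcoeff_eq0 => /eqP ->; rewrite scale0r.
move=> c g h; pose d := (msupp (c *: g + h) `|` (msupp g `|` msupp h))%fset.
have sub x : (msupp x `<=` d)%fset ->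
  free_ext F x = \sum_(p <- d) x@_p *: F p.1 p.2 by exact: E.
rewrite !sub ?fsubsetUl //; first last.
- by rewrite fsubsetU // orbC fsubsetUl.
- by rewrite fsubsetU // orbC fsubsetUr.
rewrite scaler_sumr -big_split; apply: eq_bigr => p _ /=.
by rewrite mcoeffD mcoeffZ scalerDl scalerA.
Qed.

Lemma free_ext1 F v w : free_ext F << (v, w) >> = F v w.
Proof.
by rewrite /free_ext msuppU oner_eq0 big_seq_fset1 mcoeffUU scale1r.
Qed.

Lemma tsum_pi F g : is_bilinear F -> tsum F (\pi_tensor g) = free_ext F g.
Proof.
move=> [Fl Fr]; apply/eqP; rewrite -subr_eq0.
pose L := lin (free_ext_linear F).
rewrite tsum.unlock -[free_ext F]/(L : FM -> U) -linearB.
have : repr (\pi_tensor g) - g \in @tensor_null K V W.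
  by rewrite -tensor_eqE reprK.
move/asboolP => /(_ (fun h => L h == 0)); apply.
  split=> [|c x y]; rewrite !unfold_in ?linear0 // linearP.
  by move=> /eqP -> /eqP ->; rewrite scaler0 addr0.
move=> r [[c [v [v' [w ->]]]]|[c [v [w [w' ->]]]]];
  rewrite unfold_in linearB linearP /= !free_ext1.
  by rewrite Fl subrr.
by rewrite Fr subrr.
Qed.

Lemma tsum_tens F v w : is_bilinear F -> tsum F (tens v w) = F v w.
Proof. by move=> bF; rewrite tens.unlock tsum_pi // free_ext1. Qed.

Lemma tsum_linear F : is_bilinear F -> linear (tsum F).
Proof.
move=> bF c t u; rewrite -[t]reprK -[u]reprK -linearP !tsum_pi //.
exact: free_ext_linear.
Qed.

Lemma tsumP (t : tensor) (c : K) F F' F'' :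
  (forall v w, F v w = c *: F' v w + F'' v w) ->
  tsum F t = c *: tsum F' t + tsum F'' t.
Proof.
move=> FE; rewrite tsum.unlock /free_ext scaler_sumr -big_split.
by apply: eq_bigr => p _ /=; rewrite FE scalerDr !scalerA mulrC.
Qed.

End Lift.

HB.lock Definition tlift (K : fieldType) (V W U : lmodType K) (F : V -> W -> U)
  (bF : is_bilinear F) : {linear tensor V W -> U} := lin (tsum_linear bF).

Section LiftTheory.
Variables (K : fieldType) (V W U : lmodType K) (F : V -> W -> U).
Hypothesis bF : is_bilinear F.

Lemma tlift_tsum t : tlift bF t = tsum F t.
Proof. by rewrite tlift.unlock. Qed.

Lemma tliftE v w : tlift bF (tens v w) = F v w.
Proof. by rewrite tlift_tsum tsum_tens. Qed.

End LiftTheory.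

Notation "V *t W" := (tensor V W) (at level 40, left associativity) :
  type_scope.
Notation "v \ot w" := (tens v w) (at level 40, left associativity) : ring_scope.
Notation "\tsum_ ( x , y <- t ) E" := (tsum (fun x y => E) t)
  (at level 41, x name, y name, t at level 50, E at level 41,
   format "\tsum_ ( x ,  y  <-  t )  E") : ring_scope.

Section Curry.
Variables (K : fieldType) (V W U : lmodType K) (F : V -> W -> U).
Hypothesis bF : is_bilinear F.

Lemma curry_subproof : linear (fun v => lin (bF.2 v)).
Proof. by move=> c v v'; apply: linear_mapP => w /=; case: bF => -> _. Qed.

Definition lin2 : {linear V -> {linear W -> U}} := lin curry_subproof.

End Curry.

Section TensorMaps.
Variables (K : fieldType).

Section Map.
Variables (V W V' W' : lmodType K).
Implicit Types (f : {linear V -> V'}) (g : {linear W -> W'}).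

Lemma tmap_subproof f g : is_bilinear (fun v w => f v \ot g w).
Proof.
split=> [w c v v'|v c w w']; rewrite linearP.
  exact: tens_linearl.
exact: tens_linearr.
Qed.

Definition tmap f g : {linear V *t W -> V' *t W'} := tlift (tmap_subproof f g).

Lemma tmapE f g v w : tmap f g (v \ot w) = f v \ot g w.
Proof. exact: tliftE. Qed.

Lemma tmap_linearl g : linear (tmap^~ g).
Proof.
move=> c f f'; apply: linear_mapP => t.
rewrite linear_mapD linear_mapZ !tlift_tsum.
by apply: tsumP => v w; rewrite tens_linearl.
Qed.

Lemma tmap_linearr f : linear (tmap f).
Proof.
move=> c g g'; apply: linear_mapP => t.
rewrite linear_mapD linear_mapZ !tlift_tsum.
by apply: tsumP => v w; rewrite tens_linearr.
Qed.

End Map.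

Section Associator.
Variables (V W U : lmodType K).

Lemma tassoc_subproof1 (u : U) :
  is_bilinear (fun (v : V) (w : W) => v \ot (w \ot u)).
Proof.
split=> [x c v v'|v c x x']; first exact: tens_linearl.
by rewrite tens_linearl tens_linearr.
Qed.

Lemma tassoc_subproof2 : is_bilinear (fun (t : V *t W) (u : U) =>
  \tsum_(v, w <- t) (v \ot (w \ot u))).
Proof.
split=> [u|t c u u']; first exact: tsum_linear (tassoc_subproof1 u).
by apply: tsumP => v w; rewrite !tens_linearr.
Qed.

Definition tassoc : {linear (V *t W) *t U -> V *t (W *t U)} :=
  tlift tassoc_subproof2.

Lemma tassocE v w u : tassoc ((v \ot w) \ot u) = v \ot (w \ot u).
Proof. rewrite tliftE tsum_tens //; exact: tassoc_subproof1. Qed.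

Lemma tassocV_subproof1 (v : V) :
  is_bilinear (fun (w : W) (u : U) => (v \ot w) \ot u).
Proof.
split=> [u c w w'|w c u u']; last exact: tens_linearr.
by rewrite tens_linearr tens_linearl.
Qed.

Lemma tassocV_subproof2 : is_bilinear (fun (v : V) (t : W *t U) =>
  \tsum_(w, u <- t) ((v \ot w) \ot u)).
Proof.
split=> [t c v v'|v]; last exact: tsum_linear (tassocV_subproof1 v).
by apply: tsumP => w u; rewrite !tens_linearl.
Qed.

Definition tassocV : {linear V *t (W *t U) -> (V *t W) *t U} :=
  tlift tassocV_subproof2.

Lemma tassocVE v w u : tassocV (v \ot (w \ot u)) = (v \ot w) \ot u.
Proof. rewrite tliftE tsum_tens //; exact: tassocV_subproof1. Qed.

End Associator.
End TensorMaps.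
Arguments tassoc {K} V W U.
Arguments tassocV {K} V W U.

(* Right-nested tensor powers: V, V *t V, V *t (V *t V), and so on; tjoin and *)
(* tsplit are the canonical isomorphisms moving the last factor in and out.   *)
Section TensorPower.
Variables (K : fieldType) (V : lmodType K).

Fixpoint tpow (n : nat) : lmodType K :=
  match n with
  | 0 => K^o
  | m.+1 => match m with 0 => V | _.+1 => (V *t tpow m)%type end
  end.

Fixpoint tjoin n : {linear tpow n.+1 *t V -> tpow n.+2} :=
  match n with
  | 0 => lid (V *t V)%type
  | m.+1 => tmap (lid V) (tjoin m) \ol tassoc V (tpow m.+1) V
  end.

Fixpoint tsplit n : {linear tpow n.+2 -> tpow n.+1 *t V} :=
  match n with
  | 0 => lid (V *t V)%type
  | m.+1 => tassocV V (tpow m.+1) V \ol tmap (lid V) (tsplit m)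
  end.

End TensorPower.

(* Coalgebras need not be counital, nor bialgebras unital or counital: only   *)
(* the product and the coproducts enter the complexes and deformations below. *)
HB.mixin Record isCoalgebra (K : fieldType) A of GRing.Lmodule K A := {
  comul : {linear A -> A *t A};
  comulA : tassoc A A A \ol tmap comul (lid A) \ol comul
             = tmap (lid A) comul \ol comul
}.

#[short(type="coalgType")]
HB.structure Definition Coalgebra (K : fieldType) :=
  {A of isCoalgebra K A & GRing.Lmodule K A}.

HB.mixin Record isBialgebra (K : fieldType) H of Coalgebra K H := {
  bmul : {linear H *t H -> H};
  bmulA : forall x y z : H,
    bmul (x \ot bmul (y \ot z)) = bmul (bmul (x \ot y) \ot z);
  comul_bmul : forall x y : H,
    comul (bmul (x \ot y)) =
      \tsum_(x1, x2 <- comul x) \tsum_(y1, y2 <- comul y)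
        (bmul (x1 \ot y1) \ot bmul (x2 \ot y2))
}.

#[short(type="bialgType")]
HB.structure Definition Bialgebra (K : fieldType) :=
  {H of isBialgebra K H & Coalgebra K H}.

Definition bprod (K : fieldType) (H : bialgType K) (x y : H) : H :=
  bmul (x \ot y).
Notation "x *b y" := (bprod x y) (at level 40, left associativity) : ring_scope.

Record is_module_coalgebra (K : fieldType) (H : bialgType K) (A : coalgType K)
    (lam : {linear H -> {linear A -> A}}) : Prop := IsModuleCoalgebra {
  module_mul : forall x y, lam (x *b y) = lam x \ol lam y;
  module_comul : forall x a, comul (lam x a) =
    \tsum_(x1, x2 <- comul x) \tsum_(a1, a2 <- comul a)
      (lam x1 a1 \ot lam x2 a2)
}.

Section Cohomology.
Variables (K : fieldType) (C : nat -> lmodType K).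
Variable d : forall n, C n -> C n.+1.

Definition is_cocycle n (x : C n) : Prop := d x = 0.

Definition is_coboundary n : C n -> Prop :=
  match n with
  | 0 => fun x => x = 0
  | m.+1 => fun x => exists y : C m, x = d y
  end.

Definition cohomologous n (x y : C n) : Prop := is_coboundary (x - y).

Definition trivial_cohomology n : Prop :=
  forall x : C n, is_cocycle x -> is_coboundary x.

End Cohomology.
Arguments is_cocycle {K C} d n x.
Arguments is_coboundary {K C} d n x.
Arguments cohomologous {K C} d n x y.
Arguments trivial_cohomology {K C} d n.

Section FaceMaps.
Variables (K : fieldType) (H : bialgType K) (A : coalgType K).

(* mul_at n i multiplies the tensor factors i and i + 1 and comul_at n i      *)
(* comultiplies the factor i, where factors are numbered from 0; both are 0   *)
(* out of range.                                                              *)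
Fixpoint mul_at n i : {linear tpow H n.+2 -> tpow H n.+1} :=
  match n, i with
  | 0, 0 => bmul
  | 0, _.+1 => 0
  | m.+1, 0 => tmap bmul (lid (tpow H m.+1)) \ol tassocV H H (tpow H m.+1)
  | m.+1, j.+1 => tmap (lid H) (mul_at m j)
  end.

Fixpoint comul_at n i : {linear tpow A n.+1 -> tpow A n.+2} :=
  match n, i with
  | 0, 0 => comul
  | 0, _.+1 => 0
  | m.+1, 0 => tassoc A A (tpow A m.+1) \ol tmap comul (lid (tpow A m.+1))
  | m.+1, j.+1 => tmap (lid A) (comul_at m j)
  end.

(* mconv f g x a is the Sweedler sum of the f x_(1) a_(1) \ot g x_(2) a_(2).   *)
Section Convolution.
Variables (V W : lmodType K).
Variables (f : {linear H -> {linear A -> V}}) (g : {linear H -> {linear A -> W}}).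

Lemma mconv_subproof : is_bilinear (fun x a =>
  \tsum_(x1, x2 <- comul x) \tsum_(a1, a2 <- comul a) (f x1 a1 \ot g x2 a2)).
Proof.
have b1 x1 x2 : is_bilinear (fun a1 a2 => f x1 a1 \ot g x2 a2).
  split=> [w c v v'|v c w w']; rewrite linearP; first exact: tens_linearl.
  exact: tens_linearr.
have b2 a : is_bilinear (fun x1 x2 =>
    \tsum_(a1, a2 <- comul a) (f x1 a1 \ot g x2 a2)).
  split=> [w c v v'|v c w w']; apply: tsumP => a1 a2; rewrite linearP.
    exact: tens_linearl.
  exact: tens_linearr.
split=> [a|x] c u u'; rewrite linearP.
  exact: tsum_linear (b2 a) _ _ _.
by apply: tsumP => x1 x2; apply: tsum_linear (b1 x1 x2) _ _ _.
Qed.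

Definition mconv : {linear H -> {linear A -> V *t W}} := lin2 mconv_subproof.

End Convolution.

Lemma mpost_subproof (V W : lmodType K) (g : {linear V -> W})
  (phi : {linear H -> {linear A -> V}}) : linear (fun x => g \ol phi x).
Proof.
move=> c x y; apply: linear_mapP => a; rewrite linearP.
by rewrite !(linear_mapD, linear_mapZ, lcompE) linearP.
Qed.

Definition mpost (V W : lmodType K) (g : {linear V -> W})
    (phi : {linear H -> {linear A -> V}}) : {linear H -> {linear A -> W}} :=
  lin (mpost_subproof g phi).

End FaceMaps.
Arguments mul_at {K} H n i.
Arguments comul_at {K} A n i.

Section Coderivations.
Variables (K : fieldType) (A : coalgType K).

Definition is_coderivation (phi : {linear A -> A}) : Prop :=
  comul \ol phi = (tmap (lid A) phi + tmap phi (lid A)) \ol comul.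

Definition coder_pred : {pred {linear A -> A}} :=
  fun phi => `[< is_coderivation phi >].

Lemma coder_submod_closed : submod_closed coder_pred.
Proof.
pose D f := tmap (lid A) f + tmap f (lid A).
have DP : linear D.
  by move=> c f g; rewrite /D tmap_linearl tmap_linearr scalerDr addrACA.
split=> [|c f g /asboolP df /asboolP dg]; apply/asboolP;
  apply: linear_mapP => a.
  have D0 : D 0 = 0 by have := DP (-1) 0 0; rewrite !scaleN1r !addNr.
  by rewrite -[X in _ = (X \ol _) a]/(D 0) D0; apply: linear0.
rewrite -[X in _ = (X \ol _) a]/(D (c *: f + g)) DP.
transitivity (c *: (comul \ol f) a + (comul \ol g) a); first exact: linearP.
by rewrite df dg.
Qed.
HB.instance Definition _ := GRing.isSubmodClosed.Build K {linear A -> A}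
  coder_pred coder_submod_closed.

Record coder := Coder {
  coder_val :> {linear A -> A};
  coder_valP : coder_val \in coder_pred
}.
HB.instance Definition _ := [isSub for coder_val].
HB.instance Definition _ := [Choice of coder by <:].
HB.instance Definition _ := [SubChoice_isSubLmodule of coder by <:].

End Coderivations.

(* The deformation complex F_mc(A) and its differential.                      *)
Section ModuleCoalgebraComplex.
Variables (K : fieldType) (H : bialgType K) (A : coalgType K).

Definition Fmc (n : nat) : lmodType K :=
  match n with
  | 0 => coder A
  | 1 => {linear H -> {linear A -> A}}
  | m.+2 => ({linear tpow H m.+2 -> {linear A -> A}} *
             {linear H -> {linear A -> tpow A m.+2}})%type
  end.

Variable lam : {linear H -> {linear A -> A}}.

Lemma dmc_coder_subproof (phi : {linear A -> A}) :
  linear (fun x => lam x \ol phi - phi \ol lam x).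
Proof.
move=> c x y; apply: linear_mapP => a; rewrite !linearP.
rewrite !(linear_mapD, linear_mapN, linear_mapZ, lcompE) linearP.
by rewrite scalerBr opprD addrACA.
Qed.

Definition dmc_coder (phi : coder A) : {linear H -> {linear A -> A}} :=
  lin (dmc_coder_subproof phi).

Section Degree.
Variable m : nat.

Lemma dmc0_first_subproof (phi : {linear tpow H m.+1 -> {linear A -> A}}) :
  is_bilinear (fun x u => lam x \ol phi u).
Proof.
split=> [u|x] c y y'; apply: linear_mapP => a; rewrite linearP;
by rewrite !(linear_mapD, linear_mapZ, lcompE) // linearP.
Qed.

Lemma dmc0_last_subproof (phi : {linear tpow H m.+1 -> {linear A -> A}}) :
  is_bilinear (fun u x => phi u \ol lam x).
Proof.
split=> [u|x] c y y'; apply: linear_mapP => a; rewrite linearP;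
by rewrite !(linear_mapD, linear_mapZ, lcompE) // linearP.
Qed.

(* Both components are in degree n = m.+1, and the index i of the alternating *)
(* sums is shifted by one.                                                    *)
Definition dmc0 (phi : {linear tpow H m.+1 -> {linear A -> A}}) :
    {linear tpow H m.+2 -> {linear A -> A}} :=
  tlift (dmc0_first_subproof phi)
  + \sum_(i < m.+1) (-1) ^+ i.+1 *: (phi \ol mul_at H m i)
  + (-1) ^+ m.+2 *: (tlift (dmc0_last_subproof phi) \ol tsplit H m).

Definition dmc1 (phi : {linear H -> {linear A -> tpow A m.+1}}) :
    {linear H -> {linear A -> tpow A m.+2}} :=
  mconv lam phi
  + \sum_(i < m.+1) (-1) ^+ i.+1 *: mpost (comul_at A m i) phi
  + (-1) ^+ m.+2 *: mpost (tjoin A m) (mconv phi lam).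

End Degree.

Definition dmc (n : nat) : Fmc n -> Fmc n.+1 :=
  match n with
  | 0 => dmc_coder
  | 1 => fun phi => (dmc0 (m := 0) phi, dmc1 (m := 0) phi)
  | m.+2 => fun phi => (dmc0 (m := m.+1) phi.1, dmc1 (m := m.+1) phi.2)
  end.

End ModuleCoalgebraComplex.
Arguments dmc {K H A} lam n _.

(* The Hochschild coalgebra complex C_c(A, A); 'rV[K]_0 is the zero space.    *)
Section HochschildCoalgebraComplex.
Variables (K : fieldType) (A : coalgType K).

Definition Cc (n : nat) : lmodType K :=
  match n with
  | 0 => 'rV[K]_0
  | m.+1 => {linear A -> tpow A m.+1}
  end.

Definition dc_hom m (sigma : {linear A -> tpow A m.+1}) :
    {linear A -> tpow A m.+2} :=
  tmap (lid A) sigma \ol comul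
  + \sum_(i < m.+1) (-1) ^+ i.+1 *: (comul_at A m i \ol sigma)
  + (-1) ^+ m.+2 *: (tjoin A m \ol tmap sigma (lid A) \ol comul).

Definition dc (n : nat) : Cc n -> Cc n.+1 :=
  match n with
  | 0 => fun=> 0
  | m.+1 => @dc_hom m
  end.

End HochschildCoalgebraComplex.
Arguments dc {K} A n _.

(* Formal power series in t are sequences of coefficients; pmul op is the     *)
(* t-bilinear extension of op.                                                *)
Definition pmul (U V : Type) (W : nmodType) (op : U -> V -> W)
    (f : nat -> U) (g : nat -> V) (n : nat) : W :=
  \sum_(i < n.+1) op (f i) (g (n - i)%N).

Definition pconst (V : nmodType) (v : V) (n : nat) : V :=
  if n is 0 then v else 0.

Section Deformations.
Variables (K : fieldType) (H : bialgType K) (A : coalgType K).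
Local Notation EndA := {linear A -> A}.
Implicit Types (lam : {linear H -> EndA}) (Lam : nat -> {linear H -> EndA}).
Implicit Types (Phi Psi : nat -> EndA).

Record is_deformation lam Lam : Prop := IsDeformation {
  deformation0 : Lam 0 = lam;
  deformation_mul : forall x y n,
    Lam n (x *b y) = pmul (@lcomp K A A A) (Lam^~ x) (Lam^~ y) n;
  deformation_comul : forall x a n, comul (Lam n x a) =
    \tsum_(x1, x2 <- comul x) \tsum_(a1, a2 <- comul a)
      pmul (@tens K A A) (fun i => Lam i x1 a1) (fun i => Lam i x2 a2) n
}.

Record is_formal_automorphism Phi : Prop := IsFormalAutomorphism {
  formal_automorphism0 : Phi 0 = lid A;
  formal_automorphism_comul : forall n,
    comul \ol Phi n = pmul (@tmap K A A A A) Phi Phi n \ol comul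
}.

Definition is_series_inverse Phi Psi : Prop :=
  pmul (@lcomp K A A A) Phi Psi =1 pconst (lid A) /\
  pmul (@lcomp K A A A) Psi Phi =1 pconst (lid A).

Definition equivalent_deformations Lam Lam' : Prop :=
  exists Phi Psi, [/\ is_formal_automorphism Phi, is_series_inverse Phi Psi &
    forall x n, Lam' n x =
      pmul (@lcomp K A A A) (pmul (@lcomp K A A A) Psi (Lam^~ x)) Phi n].

Definition rigid lam : Prop :=
  forall Lam, is_deformation lam Lam ->
    equivalent_deformations Lam (pconst lam).

End Deformations.

(* Main.v *)
Require Import Defs.
From mathcomp Require Import all_boot all_algebra.
From mathcomp Require Import boolp.
Set Implicit Arguments.
Unset Strict Implicit.
Unset Printing Implicit Defensive.
Import GRing.Theory.
Local Open Scope ring_scope.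

(* A series L is a solution iff its curvature D L - L . L vanishes, for a      *)
(* truncated cosimplicial algebra with product . and coface D. This has three *)
(* instances: on Hom(H, End A), (D f)(x, y) = f(xy) with composition as       *)
(* product, and D = comultiplication with the convolution product; on End A,  *)
(* D = comultiplication with convolution. If the curvature vanishes below     *)
(* degree n, its coefficient of degree n is a 2-cocycle (Bianchi identity),   *)
(* and adding u to the coefficient L n subtracts the coboundary of u from it; *)
(* so trivial second cohomology lets one solve degree by degree.              *)
(*   For rigidity, a formal automorphism Phi with L Phi = Phi lam is built    *)
(* directly, without infinite compositions: trivial H^2_c extends Phi by one  *)
(* degree as a coalgebra map, the defect L Phi - Phi lam is then a 1-cocycle, *)
(* hence the coboundary of a coderivation, and subtracting the latter from    *)
(* the new coefficient removes the defect and keeps Phi comultiplicative.     *)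

(** A series [L] is multiplicative or comultiplicative exactly when it satisfies a Maurer-Cartan
    type equation [D L = L . L]; [deformationP] says this for deformations. The curvature
    [R = D L - L . L] satisfies a Bianchi identity which follows from associativity of the products,
    the compatibility of the faces with them, and the (co)associativity law relating the two faces
    of [D L]. At the lowest nonzero order of [R] only the constant term of [L] acts, so the identity
    says that this coefficient is a 2-cocycle ([curvature_cocycle]). Changing the coefficient of
    positive degree n changes the curvature in degree n by a coboundary and leaves lower degrees
    alone ([curvature_update]). Degree 1 of the equation says that the infinitesimal is a cocycle
    ([infinitesimal_cocycle]). Comparing degree 1 of two equivalent deformations leaves the
    coboundary of the degree 1 part of the automorphism, which is a coderivation
    ([equivalent_cohomologous]). When the second cohomology vanishes, a cocycle z is integrated by
    starting from lambda + z t and killing the curvature degree by degree ([cocycle_integrable]).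
    For [rigidity] the unknown is an automorphism Phi with L Phi = Phi lambda. This equation is
    linear in Phi and needs no inverse during the induction. The first failure of L Phi = Phi lambda
    is a 1-cocycle ([defect_cocycle]), because both sides are comultiplicative through that order
    and both compose compatibly with the product of H. The limits of all degree-by-degree
    constructions come from [series_by_approximation]. *)

Section Bilinear.
Variables (K : fieldType) (V W U : lmodType K) (op : V -> W -> U).
Hypothesis op_bilin : is_bilinear op.

Lemma bilinBl v v' w : op (v - v') w = op v w - op v' w.
Proof. exact: raddfB (lin (op_bilin.1 w)) v v'. Qed.

Lemma bilinBr v w w' : op v (w - w') = op v w - op v w'.
Proof. exact: raddfB (lin (op_bilin.2 v)) w w'. Qed.

Lemma bilinDl v v' w : op (v + v') w = op v w + op v' w.
Proof. exact: raddfD (lin (op_bilin.1 w)) v v'. Qed.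

Lemma bilinDr v w w' : op v (w + w') = op v w + op v w'.
Proof. exact: raddfD (lin (op_bilin.2 v)) w w'. Qed.

Lemma bilinNl v w : op (- v) w = - op v w.
Proof. exact: raddfN (lin (op_bilin.1 w)) v. Qed.

Lemma bilinNr v w : op v (- w) = - op v w.
Proof. exact: raddfN (lin (op_bilin.2 v)) w. Qed.

Lemma bilin0l w : op 0 w = 0.
Proof. exact: raddf0 (lin (op_bilin.1 w)). Qed.

Lemma bilin0r v : op v 0 = 0.
Proof. exact: raddf0 (lin (op_bilin.2 v)). Qed.

Lemma bilin_suml I (r : seq I) P (F : I -> V) w :
  op (\sum_(i <- r | P i) F i) w = \sum_(i <- r | P i) op (F i) w.
Proof. exact: raddf_sum (lin (op_bilin.1 w)) _ _ _ _. Qed.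

Lemma bilin_sumr I (r : seq I) P (F : I -> W) v :
  op v (\sum_(i <- r | P i) F i) = \sum_(i <- r | P i) op v (F i).
Proof. exact: raddf_sum (lin (op_bilin.2 v)) _ _ _ _. Qed.

Lemma eq_pmul_low f f' g g' n :
  (forall i, (i <= n)%N -> f i = f' i) -> (forall i, (i <= n)%N -> g i = g' i) ->
  pmul op f g n = pmul op f' g' n.
Proof.
by move=> ff' gg'; apply: eq_bigr => i _; rewrite ff' ?gg' ?leq_subr -1?ltnS.
Qed.

Lemma pmul_lowl f g n : (forall i, (i < n)%N -> f i = 0) ->
  pmul op f g n = op (f n) (g 0).
Proof.
move=> f0; rewrite /pmul big_ord_recr /= subnn big1 ?add0r // => i _.
by rewrite f0 ?bilin0l ?ltn_ord.
Qed.

Lemma pmul_lowr f g n : (forall i, (i < n)%N -> g i = 0) ->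
  pmul op f g n = op (f 0) (g n).
Proof.
move=> g0; rewrite /pmul big_ord_recl /= subn0 big1 ?addr0 // => i _.
by rewrite g0 ?bilin0r // /bump /= ltn_subrL ltnS (leq_trans _ (ltn_ord i)).
Qed.

Lemma pmul_constl v g n : pmul op (pconst v) g n = op v (g n).
Proof.
rewrite /pmul big_ord_recl /= subn0 big1 ?addr0 // => i _.
by rewrite bilin0l.
Qed.

Lemma pmul_constr f w n : pmul op f (pconst w) n = op (f n) w.
Proof.
rewrite /pmul big_ord_recr /= subnn big1 ?add0r // => i _.
have : (0 < n - i)%N by rewrite subn_gt0.
by case: (n - i)%N => // m _; rewrite bilin0r.
Qed.

Lemma pmulBl f f' g n :
  pmul op (fun i => f i - f' i) g n = pmul op f g n - pmul op f' g n.
Proof. by rewrite -sumrB; apply: eq_bigr => i _; rewrite bilinBl. Qed.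

Lemma pmulBr f g g' n :
  pmul op f (fun i => g i - g' i) n = pmul op f g n - pmul op f g' n.
Proof. by rewrite -sumrB; apply: eq_bigr => i _; rewrite bilinBr. Qed.

Lemma pmul_extremes f g n : pmul op f g n.+1 =
  op (f 0) (g n.+1) + \sum_(i < n) op (f i.+1) (g (n - i)%N) + op (f n.+1) (g 0).
Proof.
rewrite /pmul big_ord_recr big_ord_recl /= subnn subn0.
by congr (_ + _ + _).
Qed.

(** In degree n+1 the new coefficients meet only the constant terms. No quadratic term in the
    changes appears, since its degree would be 2n+2. *)
Lemma pmul_update f g f' g' n :
  (forall i, (i <= n)%N -> f' i = f i) -> (forall i, (i <= n)%N -> g' i = g i) ->
  pmul op f' g' n.+1 = pmul op f g n.+1 + op (f 0) (g' n.+1 - g n.+1)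
                       + op (f' n.+1 - f n.+1) (g 0).
Proof.
move=> ff' gg'; rewrite !pmul_extremes (ff' 0) // (gg' 0) // bilinBl bilinBr.
under eq_bigr => i _ do rewrite ff' // gg' ?leq_subr //.
set s := \sum_(i < n) _; rewrite -[RHS]addrA (addrACA (op _ _) (- _)) -opprD.
by rewrite (addrAC _ s) (addrAC _ s) [RHS]addrC addrA subrK.
Qed.

(* The square of indices does not depend on n, so that nested sums of this   *)
(* form can be exchanged freely.                                             *)
Lemma pmul_square N f g n : (n < N)%N ->
  pmul op f g n = \sum_(i < N) \sum_(j < N) op (f i) (g j) *+ (i + j == n)%N.
Proof.
move=> nN; rewrite /pmul (big_ord_widen N (fun i => op (f i) (g (n - i)%N))) //.
rewrite big_mkcond; apply: eq_bigr => i _ /=.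
have [le_in|lt_ni] := leqP i n; rewrite ltnS.
  have lt_niN : (n - i < N)%N by rewrite (leq_ltn_trans (leq_subr _ _)).
  rewrite le_in (bigD1 (Ordinal lt_niN)) //= subnKC // eqxx mulr1n.
  rewrite big1 ?addr0 // => j /eqP ne_j.
  by case: eqP => // eqn; case: ne_j; apply: val_inj; rewrite /= -eqn addKn.
rewrite leqNgt lt_ni big1 // => j _.
by rewrite gtn_eqF // (leq_trans lt_ni) // leq_addr.
Qed.

End Bilinear.

Lemma pmul0 (U V : Type) (W : nmodType) (op : U -> V -> W) f g :
  pmul op f g 0 = op (f 0) (g 0).
Proof. exact: big_ord1. Qed.

Lemma pmul1 (U V : Type) (W : nmodType) (op : U -> V -> W) f g :
  pmul op f g 1 = op (f 0) (g 1%N) + op (f 1%N) (g 0).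
Proof. by rewrite /pmul big_ord_recl big_ord1. Qed.

Lemma pmul_map (U V : Type) (W W' : nmodType) (op : U -> V -> W)
    (L : {additive W -> W'}) f g n :
  L (pmul op f g n) = pmul (fun u v => L (op u v)) f g n.
Proof. exact: raddf_sum. Qed.

(** * Associativity and interchange laws for products of power series *)

Section PowerSeriesProducts.
Variable K : fieldType.

(** Eliminates the intermediate degree of a nested product. If m is at least N, both sides vanish
    because n < N, so m needs no bound. *)
Lemma sum_indicator_eq (V : nmodType) (N n m j : nat) (x : V) : (n < N)%N ->
  \sum_(i < N) x *+ ((m == i) && (i + j == n))%N = x *+ (m + j == n)%N.
Proof.
move=> nN; have [lt_mN|le_Nm] := ltnP m N.
  rewrite (bigD1 (Ordinal lt_mN)) //= eqxx big1 ?addr0 // => i /eqP ne_i.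
  by case: eqP => //= eqm; case: ne_i; apply: val_inj.
rewrite big1 => [|i _]; last by rewrite gtn_eqF // (leq_trans _ le_Nm).
by rewrite gtn_eqF // (leq_trans nN) // (leq_trans le_Nm) // leq_addr.
Qed.

Section Cubes.
Variables (V1 V2 V3 W X : lmodType K).

Lemma pmul_cubel (op1 : W -> V3 -> X) (op2 : V1 -> V2 -> W) N f g h n :
  is_bilinear op1 -> is_bilinear op2 -> (n < N)%N ->
  pmul op1 (pmul op2 f g) h n = \sum_(i < N) \sum_(j < N) \sum_(k < N)
    op1 (op2 (f i) (g j)) (h k) *+ (i + j + k == n)%N.
Proof.
move=> b1 b2 nN; rewrite (pmul_square _ _ _ nN).
transitivity (\sum_(a < N) \sum_(k < N) \sum_(i < N) \sum_(j < N)
   op1 (op2 (f i) (g j)) (h k) *+ ((i + j == a) && (a + k == n))%N).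
  apply: eq_bigr => a _; apply: eq_bigr => k _.
  rewrite (pmul_square _ _ _ (ltn_ord a)) bilin_suml // -sumrMnl.
  apply: eq_bigr => i _; rewrite bilin_suml // -sumrMnl; apply: eq_bigr => j _.
  by rewrite andbC; case: eqP => _; case: eqP => _; rewrite ?bilin0l.
rewrite exchange_big /=.
transitivity (\sum_(k < N) \sum_(i < N) \sum_(j < N)
   op1 (op2 (f i) (g j)) (h k) *+ (i + j + k == n)%N).
  apply: eq_bigr => k _; rewrite exchange_big; apply: eq_bigr => i _.
  rewrite exchange_big; apply: eq_bigr => j _; exact: sum_indicator_eq.
rewrite exchange_big; apply: eq_bigr => i _; exact: exchange_big.
Qed.

Lemma pmul_cuber (op1 : V1 -> W -> X) (op2 : V2 -> V3 -> W) N f g h n :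
  is_bilinear op1 -> is_bilinear op2 -> (n < N)%N ->
  pmul op1 f (pmul op2 g h) n = \sum_(i < N) \sum_(j < N) \sum_(k < N)
    op1 (f i) (op2 (g j) (h k)) *+ (i + j + k == n)%N.
Proof.
move=> b1 b2 nN; rewrite (pmul_square _ _ _ nN); apply: eq_bigr => i _.
transitivity (\sum_(a < N) \sum_(j < N) \sum_(k < N)
   op1 (f i) (op2 (g j) (h k)) *+ ((j + k == a) && (a + i == n))%N).
  apply: eq_bigr => a _.
  rewrite (pmul_square _ _ _ (ltn_ord a)) bilin_sumr // -sumrMnl.
  apply: eq_bigr => j _; rewrite bilin_sumr // -sumrMnl; apply: eq_bigr => k _.
  rewrite andbC [(a + i)%N]addnC.
  by case: eqP => _; case: eqP => _; rewrite ?bilin0r.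
rewrite exchange_big; apply: eq_bigr => j _.
rewrite exchange_big; apply: eq_bigr => k _.
by rewrite sum_indicator_eq // addnC addnA.
Qed.

End Cubes.

Lemma pmulA (V1 V2 V3 W12 W23 X : lmodType K)
    (opl : W12 -> V3 -> X) (op12 : V1 -> V2 -> W12)
    (opr : V1 -> W23 -> X) (op23 : V2 -> V3 -> W23) f g h n :
  is_bilinear opl -> is_bilinear op12 -> is_bilinear opr -> is_bilinear op23 ->
  (forall x y z, opl (op12 x y) z = opr x (op23 y z)) ->
  pmul opl (pmul op12 f g) h n = pmul opr f (pmul op23 g h) n.
Proof.
move=> bl b12 br b23 A; rewrite (pmul_cubel _ _ _ bl b12 (ltnSn n)).
rewrite (pmul_cuber _ _ _ br b23 (ltnSn n)).
apply: eq_bigr => i _; apply: eq_bigr => j _; apply: eq_bigr => k _.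
by rewrite A.
Qed.

(** Both sides become one sum over quadruples of indices of total degree n ([tesseract]), where
    swapping the two middle indices is an exchange of sums. *)
Lemma pmulACA (V1 V2 V3 V4 W12 W34 W13 W24 X : lmodType K)
    (opl : W12 -> W34 -> X) (op12 : V1 -> V2 -> W12) (op34 : V3 -> V4 -> W34)
    (opr : W13 -> W24 -> X) (op13 : V1 -> V3 -> W13) (op24 : V2 -> V4 -> W24)
    a b c d n :
  is_bilinear opl -> is_bilinear op12 -> is_bilinear op34 ->
  is_bilinear opr -> is_bilinear op13 -> is_bilinear op24 ->
  (forall x y z t, opl (op12 x y) (op34 z t) = opr (op13 x z) (op24 y t)) ->
  pmul opl (pmul op12 a b) (pmul op34 c d) n
    = pmul opr (pmul op13 a c) (pmul op24 b d) n.
Proof.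
have tesseract (U1 U2 U3 U4 U12 U34 : lmodType K)
    (op : U12 -> U34 -> X) (o12 : U1 -> U2 -> U12) (o34 : U3 -> U4 -> U34)
    f1 f2 f3 f4 :
    is_bilinear op -> is_bilinear o12 -> is_bilinear o34 ->
    pmul op (pmul o12 f1 f2) (pmul o34 f3 f4) n
    = \sum_(i < n.+1) \sum_(j < n.+1) \sum_(k < n.+1) \sum_(l < n.+1)
        op (o12 (f1 i) (f2 j)) (o34 (f3 k) (f4 l)) *+ (i + j + (k + l) == n)%N.
  move=> bop b12 b34; rewrite (pmul_cubel _ _ _ bop b12 (ltnSn n)).
  apply: eq_bigr => i _; apply: eq_bigr => j _.
  transitivity (\sum_(e < n.+1) \sum_(k < n.+1) \sum_(l < n.+1)
     op (o12 (f1 i) (f2 j)) (o34 (f3 k) (f4 l))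
       *+ ((k + l == e) && (e + (i + j) == n))%N).
    apply: eq_bigr => e _.
    rewrite (pmul_square _ _ _ (ltn_ord e)) bilin_sumr // -sumrMnl.
    apply: eq_bigr => k _; rewrite bilin_sumr // -sumrMnl.
    apply: eq_bigr => l _; rewrite andbC [(e + _)%N]addnC.
    by case: eqP => _; case: eqP => _; rewrite ?bilin0r.
  rewrite exchange_big; apply: eq_bigr => k _.
  rewrite exchange_big; apply: eq_bigr => l _.
  by rewrite sum_indicator_eq // [(k + l + _)%N]addnC.
move=> bl b12 b34 br b13 b24 E; rewrite !tesseract //.
apply: eq_bigr => i _; rewrite exchange_big; apply: eq_bigr => k _.
apply: eq_bigr => j _; apply: eq_bigr => l _.
by rewrite E addnACA.
Qed.

End PowerSeriesProducts.

(** * Construction of a series by successive approximation *)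

(** [P n] looks only at coefficients up to n + m, and the step to n+1 alters only later ones. The
    approximations chosen successively therefore stabilize, and their diagonal is the limit. The
    offset m protects the coefficients of degree at most m prescribed by [f0]. *)
Lemma series_by_approximation (T : Type) (m : nat) (P : nat -> (nat -> T) -> Prop)
    (f0 : nat -> T) :
  (forall n f g, (forall i, (i <= n + m)%N -> f i = g i) -> P n f -> P n g) ->
  P 0 f0 ->
  (forall n f, P n f ->
     exists2 g, forall i, (i <= n + m)%N -> g i = f i & P n.+1 g) ->
  exists2 f, forall i, (i <= m)%N -> f i = f0 i & forall n, P n f.
Proof.
move=> Pext P0 Pstep.
have Pstep' n (f : {f | P n f}) : {g : {g | P n.+1 g} |
    forall i, (i <= n + m)%N -> sval g i = sval f i}.
  by have [g gf Pg] := cid2 (Pstep n _ (svalP f)); exists (exist _ g Pg).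
pose s := fix s n : {f | P n f} :=
  if n is n'.+1 then sval (Pstep' n' (s n')) else exist _ f0 P0.
have s_stable n k i : (i <= n + m)%N -> sval (s (n + k)%N) i = sval (s n) i.
  move=> le_in; elim: k => [|k IHk]; first by rewrite addn0.
  rewrite addnS -IHk; apply: (svalP (Pstep' _ (s (n + k)))).
  by rewrite addnAC (leq_trans le_in) ?leq_addr.
have s_stable' n n' i : (n <= n')%N -> (i <= n + m)%N ->
    sval (s n') i = sval (s n) i by move=> /subnKC <-; exact: s_stable.
exists (fun i => sval (s i) i) => [i le_im|n]; first exact: (s_stable' 0).
apply: (Pext n (sval (s n))) (svalP (s n)) => i le_in.
(* Whichever of the approximations i and n comes first has already fixed coefficient i, as i is at
   most both i + m and n + m. *)
have [le_in'|/ltnW le_ni] := leqP i n; last by rewrite (s_stable' n i).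
by rewrite (s_stable' i n) // leq_addr.
Qed.

(** * The abstract curvature, its Bianchi identity and its variation *)

Section Curvature.
Variables (K : fieldType) (M1 M2 M3 : lmodType K).
Variables (c11 : M1 -> M1 -> M2) (c12 : M1 -> M2 -> M3) (c21 : M2 -> M1 -> M3).
Variables (D : M1 -> M2) (DL DR : M2 -> M3).
Hypotheses (c11_bilin : is_bilinear c11) (c12_bilin : is_bilinear c12).
Hypotheses (c21_bilin : is_bilinear c21).
Hypotheses (D_lin : linear D) (DL_lin : linear DL) (DR_lin : linear DR).
Hypothesis cA : forall f g h, c21 (c11 f g) h = c12 f (c11 g h).
Hypothesis DLc : forall f g, DL (c11 f g) = c21 (D f) g.
Hypothesis DRc : forall f g, DR (c11 f g) = c12 f (D g).
Hypothesis DLD : forall f, DL (D f) = DR (D f).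

Definition curvature (L : nat -> M1) (n : nat) : M2 := D (L n) - pmul c11 L L n.

Lemma eq_curvature L L' n : (forall i, (i <= n)%N -> L i = L' i) ->
  curvature L n = curvature L' n.
Proof.
by move=> LL'; rewrite /curvature LL' // (eq_pmul_low _ LL' LL').
Qed.

(* The Bianchi identity: it holds for the whole series, and its lowest-order *)
(* term involves L only through L 0.                                         *)
Lemma curvature_cocycle L n : (forall i, (i < n)%N -> curvature L i = 0) ->
  c12 (L 0) (curvature L n) - DL (curvature L n) + DR (curvature L n)
    - c21 (curvature L n) (L 0) = 0.
Proof.
move=> L_flat.
rewrite -(pmul_lowr c12_bilin L L_flat) -(pmul_lowl c21_bilin L L_flat).
rewrite [X in pmul c12 _ X]/curvature [X in pmul c21 X]/curvature.
rewrite pmulBr // pmulBl //.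
rewrite (pmulA _ _ _ _ c21_bilin c11_bilin c12_bilin c11_bilin cA).
rewrite /curvature [DL _](raddfB (lin DL_lin)) [DR _](raddfB (lin DR_lin)) /= DLD.
have -> : DL (pmul c11 L L n) = pmul c21 (fun i => D (L i)) L n.
  rewrite [LHS](pmul_map _ (lin DL_lin)) /=.
  by apply: eq_bigr => i _; rewrite DLc.
have -> : DR (pmul c11 L L n) = pmul c12 L (fun i => D (L i)) n.
  rewrite [LHS](pmul_map _ (lin DR_lin)) /=.
  by apply: eq_bigr => i _; rewrite DRc.
set a := pmul c12 _ _ _; set b := pmul c12 _ _ _; set c := pmul _ _ _ _.
set d := DR _.
rewrite -addrA -addrA opprB -[d - _ - _]addrA subrKA -opprD addrA.
by rewrite [X in _ - X]addrA [X in _ - X]addrAC subrr.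
Qed.

(** The subtracted term is the degree 1 differential of [w], with [L 0] as structure map. It is
    exact rather than a first-order approximation, by [pmul_update]. *)
Lemma curvature_update L L' n : (forall i, (i <= n)%N -> L' i = L i) ->
  let w := L' n.+1 - L n.+1 in
  curvature L' n.+1
    = curvature L n.+1 - (c11 (L 0) w - D w + c11 w (L 0)).
Proof.
move=> LL' w; rewrite /curvature (pmul_update c11_bilin LL' LL') -/w.
have -> : L' n.+1 = L n.+1 + w by rewrite addrC subrK.
rewrite [D _](raddfD (lin D_lin)) /= -[LHS]addrA -[RHS]addrA -opprD.
rewrite -(opprB _ (D w)); congr (_ - _).
by rewrite !addrA (addrAC _ (- D w)).
Qed.

Lemma curvature1 L :
  curvature L 1 = - (c11 (L 0) (L 1%N) - D (L 1%N) + c11 (L 1%N) (L 0)).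
Proof.
rewrite /curvature pmul_extremes big_ord0 addr0 !opprD opprK addrA.
by rewrite (addrC (D _)).
Qed.

End Curvature.

(** * Calculus of linear maps, tensor products and Sweedler sums *)

Section TensorCalculus.
Variable K : fieldType.

Lemma linear_mapB (V W : lmodType K) (f g : {linear V -> W}) x :
  (f - g : {linear V -> W}) x = f x - g x.
Proof. by []. Qed.

Lemma linear_mapB2 (U V W : lmodType K) (f g : {linear U -> {linear V -> W}}) x y :
  (f - g : {linear U -> {linear V -> W}}) x y = f x y - g x y.
Proof. by []. Qed.

Lemma lcomp_bilin (U V W : lmodType K) : is_bilinear (@lcomp K U V W).
Proof.
split=> [g c f f'|f c g g']; apply: linear_mapP => x //.
by rewrite !(linear_mapD, linear_mapZ, lcompE) linearP.
Qed.

Lemma lcompA (U V W X : lmodType K) (f : {linear W -> X}) (g : {linear V -> W})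
  (h : {linear U -> V}) : f \ol (g \ol h) = f \ol g \ol h.
Proof. exact: linear_mapP. Qed.

Lemma lcomp1f (V W : lmodType K) (f : {linear V -> W}) : lid W \ol f = f.
Proof. exact: linear_mapP. Qed.

Lemma lcompf1 (V W : lmodType K) (f : {linear V -> W}) : f \ol lid V = f.
Proof. exact: linear_mapP. Qed.

Lemma tens_bilin (V W : lmodType K) : is_bilinear (@tens K V W).
Proof. by split; [apply: tens_linearl | apply: tens_linearr]. Qed.

Lemma tmap_bilin (V W V' W' : lmodType K) : is_bilinear (@tmap K V W V' W').
Proof. by split; [apply: tmap_linearl | apply: tmap_linearr]. Qed.

Lemma tensor_linear_ext (V W X : lmodType K) (f g : {linear V *t W -> X}) :
  (forall v w, f (v \ot w) = g (v \ot w)) -> f = g.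
Proof.
move=> fg; apply: linear_mapP; apply: tensor_ind => // t u ft fu.
by rewrite !linearD ft fu.
Qed.

Lemma tmap_comp (V W V' W' V2 W2 : lmodType K) (f : {linear V' -> V2})
    (g : {linear W' -> W2}) (f' : {linear V -> V'}) (g' : {linear W -> W'}) :
  tmap (f \ol f') (g \ol g') = tmap f g \ol tmap f' g'.
Proof.
by apply: tensor_linear_ext => v w; rewrite lcompE !tmapE !lcompE.
Qed.

Lemma tmap1 (V W : lmodType K) : tmap (lid V) (lid W) = lid (V *t W)%type.
Proof. by apply: tensor_linear_ext => v w; rewrite tmapE. Qed.

Lemma tassoc_natural (V W U V' W' U' : lmodType K) (f : {linear V -> V'})
    (g : {linear W -> W'}) (h : {linear U -> U'}) :
  tassoc V' W' U' \ol tmap (tmap f g) h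
    = tmap f (tmap g h) \ol tassoc V W U.
Proof.
apply: tensor_linear_ext => t u; move: t; apply: tensor_ind => [v w|t t' Et Et'].
  by rewrite !lcompE tmapE tmapE tassocE tassocE !tmapE.
by rewrite (bilinDl (@tens_bilin _ _)) !linearD Et Et'.
Qed.

Lemma eq_tsum (V W U : lmodType K) (F G : V -> W -> U) (t : V *t W) :
  (forall v w, F v w = G v w) -> tsum F t = tsum G t.
Proof. by move=> FG; congr (tsum _ t); apply/funext => v; apply/funext => w. Qed.

Lemma tsum_map (V W U U' : lmodType K) (L : {linear U -> U'}) (F : V -> W -> U)
  (t : V *t W) : L (tsum F t) = \tsum_(v, w <- t) L (F v w).
Proof.
rewrite !tsum.unlock /free_ext linear_sum; apply: eq_bigr => p _.
by rewrite linearZ.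
Qed.

Lemma tsum_sum (V W U : lmodType K) I (r : seq I) (F : I -> V -> W -> U)
    (t : V *t W) :
  \tsum_(v, w <- t) (\sum_(i <- r) F i v w) = \sum_(i <- r) tsum (F i) t.
Proof.
rewrite !tsum.unlock /free_ext exchange_big; apply: eq_bigr => p _.
by rewrite scaler_sumr.
Qed.

(** Coassociativity in Sweedler notation. A [tsum] runs over a chosen representative, so nested sums
    cannot be compared termwise; trilinearity of [F] turns both sides into one linear map [tlift bG]
    applied to the two sides of [comulA]. *)
Lemma tsum_comulA (C : coalgType K) (U : lmodType K) (F : C -> C -> C -> U) x :
  (forall y z, linear (F^~ y ^~ z)) -> (forall y z, linear ((F y)^~ z)) ->
  (forall y z, linear (F y z)) ->
  \tsum_(x1, x2 <- comul x) \tsum_(y1, y2 <- comul x1) F y1 y2 x2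
    = \tsum_(x1, x2 <- comul x) \tsum_(y1, y2 <- comul x2) F x1 y1 y2.
Proof.
move=> F1 F2 F3.
have bF y : is_bilinear (F y) by split=> z; [apply: F2 | apply: F3].
have bG : is_bilinear (fun y t => tsum (F y) t).
  split=> [t c y y'|y]; last exact: tsum_linear.
  by apply: tsumP => z z'; apply: F1.
have bF' z : is_bilinear (fun y y' => F y y' z).
  by split=> y; [apply: F1 | apply: F2].
have bG' : is_bilinear (fun t z => \tsum_(y, y' <- t) F y y' z).
  split=> [z|t c z z']; first exact: tsum_linear.
  by apply: tsumP => y y'; apply: F3.
have bH : is_bilinear (fun y z => tlift bG' (comul y \ot z)).
  split=> [z c y y'|y c z z']; first by rewrite linearP tens_linearl linearP.
  by rewrite tens_linearr linearP.
have bH' : is_bilinear (fun y z => tlift bG (y \ot comul z)).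
  split=> [z c y y'|y c z z']; last by rewrite linearP tens_linearr linearP.
  by rewrite tens_linearl linearP.
transitivity (\tsum_(x1, x2 <- comul x) tlift bG' (comul x1 \ot x2)).
  by apply: eq_tsum => y z; rewrite tliftE.
transitivity (\tsum_(x1, x2 <- comul x) tlift bG (x1 \ot comul x2)); last first.
  by apply: eq_tsum => y z; rewrite tliftE.
rewrite -!tlift_tsum.
have -> : tlift bH = tlift bG \ol tassoc C C C \ol tmap comul (lid C).
  apply: tensor_linear_ext => y z; rewrite [LHS]tliftE !lcompE tmapE.
  move: (comul y); apply: tensor_ind => [y1 y2|t t' Et Et'].
    by rewrite tassocE !tliftE !tsum_tens.
  by rewrite (bilinDl (@tens_bilin _ _)) !linearD Et Et'.
have -> : tlift bH' = tlift bG \ol tmap (lid C) comul.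
  by apply: tensor_linear_ext => y z; rewrite [LHS]tliftE lcompE tmapE.
pose E (f : {linear C -> C *t (C *t C)}) := tlift bG (f x).
exact: (congr1 E (@comulA _ C)).
Qed.

End TensorCalculus.

(** * Convolution on maps out of A and the complex of coalgebra cochains *)

Section CoalgebraConvolution.
Variables (K : fieldType) (A : coalgType K).

Definition aconv (V W : lmodType K) (f : {linear A -> V}) (g : {linear A -> W}) :
  {linear A -> V *t W} := tmap f g \ol comul.

Lemma aconv_bilin (V W : lmodType K) : is_bilinear (@aconv V W).
Proof.
split=> [g|f] c x y; rewrite /aconv.
  by rewrite tmap_linearl (lcomp_bilin _ _ _).1.
by rewrite tmap_linearr (lcomp_bilin _ _ _).1.
Qed.

Lemma lcomp_aconv (V W V' W' : lmodType K) (f : {linear A -> V})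
    (g : {linear A -> W}) (p : {linear V -> V'}) (q : {linear W -> W'}) :
  tmap p q \ol aconv f g = aconv (p \ol f) (q \ol g).
Proof. by rewrite /aconv tmap_comp lcompA. Qed.

Lemma aconvA (V W U : lmodType K) (f : {linear A -> V}) (g : {linear A -> W})
    (h : {linear A -> U}) :
  tassoc V W U \ol aconv (aconv f g) h = aconv f (aconv g h).
Proof.
rewrite /aconv -{1}(lcompf1 h) tmap_comp !lcompA tassoc_natural.
rewrite -(lcompA _ (tassoc _ _ _)) -(lcompA _ _ comul) comulA lcompA -tmap_comp.
by rewrite lcompf1.
Qed.

(** Coassociativity in the shape [DLD] required by the curvature section. The two lemmas that follow
    supply [DLc] and [DRc]. *)
Lemma comul_at_comul (f : {linear A -> A}) :
  comul_at A 1 0 \ol (comul \ol f) = comul_at A 1 1 \ol (comul \ol f).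
Proof. by rewrite /= !lcompA comulA. Qed.

Lemma comul_at0_aconv (f g : {linear A -> A}) :
  comul_at A 1 0 \ol aconv f g = tassoc A A A \ol aconv (comul \ol f) g.
Proof. by rewrite /= -lcompA lcomp_aconv lcomp1f. Qed.

Lemma comul_at1_aconv (f g : {linear A -> A}) :
  comul_at A 1 1 \ol aconv f g = aconv f (comul \ol g).
Proof. by rewrite /= lcomp_aconv lcomp1f. Qed.

Lemma tjoin1 : tjoin A 1 = tassoc A A A :> {linear _ -> _}.
Proof. by rewrite /= tmap1 lcomp1f. Qed.

Lemma dc1E (f : {linear A -> A}) :
  dc A 1 f = aconv (lid A) f - comul \ol f + aconv f (lid A).
Proof.
rewrite /= /dc_hom big_ord1 /= expr1 scaleN1r sqrrN expr1n scale1r.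
by rewrite -lcompA lcomp1f.
Qed.

Lemma dc2E (G : {linear A -> tpow A 2}) :
  dc A 2 G = aconv (lid A) G - comul_at A 1 0 \ol G + comul_at A 1 1 \ol G
             - tassoc A A A \ol aconv G (lid A).
Proof.
rewrite /= /dc_hom !big_ord_recl big_ord0 addr0 /= expr1 scaleN1r sqrrN expr1n.
rewrite scale1r addrA -(signr_odd _ 3) expr1 scaleN1r.
by rewrite tmap1 lcomp1f -[in LHS]lcompA.
Qed.

End CoalgebraConvolution.

(** * Convolution on maps from H to Hom(A, V) *)

Section ModuleConvolution.
Variables (K : fieldType) (H : bialgType K) (A : coalgType K).
Local Notation Hom V := {linear H -> {linear A -> V}}.

Lemma mpostE (V W : lmodType K) (g : {linear V -> W}) (f : Hom V) x :
  mpost g f x = g \ol f x.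
Proof. by []. Qed.

Lemma mpost_linear (V W : lmodType K) (g : {linear V -> W}) :
  linear (@mpost K H A V W g).
Proof.
move=> c f f'; apply: linear_mapP => x.
by rewrite mpostE (lcomp_bilin _ _ _).2.
Qed.

Lemma mpost_bilin (V W : lmodType K) : is_bilinear (@mpost K H A V W).
Proof.
split=> [f c g g'|g]; last exact: mpost_linear.
by apply: linear_mapP => x; rewrite mpostE (lcomp_bilin _ _ _).1.
Qed.

Lemma mpre_subproof (V : lmodType K) (f : Hom V) (phi : {linear A -> A}) :
  linear (fun x => f x \ol phi).
Proof. by move=> c x y; rewrite linearP (lcomp_bilin _ _ _).1. Qed.

Definition mpre (V : lmodType K) (f : Hom V) (phi : {linear A -> A}) : Hom V :=
  lin (mpre_subproof f phi).

Lemma mpreE (V : lmodType K) (f : Hom V) (phi : {linear A -> A}) x :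
  mpre f phi x = f x \ol phi.
Proof. by []. Qed.

(** With [x] fixed, convolution over H is a Sweedler sum of convolutions over A. This is how the
    identities for [aconv] carry over to [mconv]. *)
Lemma mconvE (V W : lmodType K) (f : Hom V) (g : Hom W) x :
  mconv f g x = \tsum_(x1, x2 <- comul x) aconv (f x1) (g x2).
Proof.
apply: linear_mapP => a.
have ev_lin : linear (fun h : {linear A -> V *t W} => h a) by [].
rewrite [RHS](tsum_map (lin ev_lin)); apply: eq_tsum => x1 x2.
by rewrite /= tlift_tsum.
Qed.

Lemma mconv_bilin (V W : lmodType K) : is_bilinear (@mconv K H A V W).
Proof.
split=> [g|f] c h h'; apply: linear_mapP => x.
  transitivity (c *: mconv h g x + mconv h' g x) => //.
  by rewrite !mconvE; apply: tsumP => x1 x2; rewrite -(aconv_bilin _ _ _).1.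
transitivity (c *: mconv f h x + mconv f h' x) => //.
by rewrite !mconvE; apply: tsumP => x1 x2; rewrite -(aconv_bilin _ _ _).2.
Qed.

Lemma lcomp_mconv (V W X : lmodType K) (p : {linear V *t W -> X}) (f : Hom V)
    (g : Hom W) x :
  p \ol mconv f g x = \tsum_(x1, x2 <- comul x) (p \ol aconv (f x1) (g x2)).
Proof.
by rewrite mconvE [LHS](tsum_map (lin ((lcomp_bilin _ _ _).2 p))).
Qed.

Lemma mpost_mconv (V W V' W' : lmodType K) (f : Hom V) (g : Hom W)
    (p : {linear V -> V'}) (q : {linear W -> W'}) :
  mpost (tmap p q) (mconv f g) = mconv (mpost p f) (mpost q g).
Proof.
apply: linear_mapP => x; rewrite mpostE lcomp_mconv mconvE.
by apply: eq_tsum => x1 x2; rewrite lcomp_aconv.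
Qed.

Lemma mpost_comp (V W X : lmodType K) (p : {linear W -> X}) (q : {linear V -> W})
  (f : Hom V) : mpost (p \ol q) f = mpost p (mpost q f).
Proof. by apply: linear_mapP => x; rewrite !mpostE lcompA. Qed.

Lemma mpost1 (V : lmodType K) (f : Hom V) : mpost (lid V) f = f.
Proof. by apply: linear_mapP => x; rewrite mpostE lcomp1f. Qed.

Lemma mconvA (V W U : lmodType K) (f : Hom V) (g : Hom W) (h : Hom U) :
  mpost (tassoc V W U) (mconv (mconv f g) h) = mconv f (mconv g h).
Proof.
apply: linear_mapP => x; rewrite mpostE lcomp_mconv mconvE.
pose T x1 x2 x3 := aconv (f x1) (aconv (g x2) (h x3)).
transitivity (\tsum_(x1, x2 <- comul x) \tsum_(y1, y2 <- comul x1) T y1 y2 x2).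
  apply: eq_tsum => x1 x2; rewrite mconvE.
  have bL : linear (fun k : {linear A -> V *t W} => tassoc V W U \ol aconv k (h x2)).
    by move=> c k k'; rewrite (aconv_bilin _ _ _).1 (lcomp_bilin _ _ _).2.
  rewrite [LHS](tsum_map (lin bL)); apply: eq_tsum => y1 y2.
  exact: aconvA.
rewrite tsum_comulA /T.
- apply: eq_tsum => x1 x2; rewrite mconvE.
  by rewrite [RHS](tsum_map (lin ((aconv_bilin _ _ _).2 (f x1)))).
- by move=> y z c k k'; rewrite linearP (aconv_bilin _ _ _).1.
- by move=> y z c k k'; rewrite linearP (aconv_bilin _ _ _).1 (aconv_bilin _ _ _).2.
- by move=> y z c k k'; rewrite linearP !(aconv_bilin _ _ _).2.
Qed.

Lemma mpost_comul_at_comul (f : Hom A) :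
  mpost (comul_at A 1 0) (mpost comul f) = mpost (comul_at A 1 1) (mpost comul f).
Proof. by apply: linear_mapP => x; rewrite !mpostE comul_at_comul. Qed.

Lemma mpost_comul_at0_mconv (f g : Hom A) :
  mpost (comul_at A 1 0) (mconv f g)
    = mpost (tassoc A A A) (mconv (mpost comul f) g).
Proof. by rewrite /= mpost_comp mpost_mconv mpost1. Qed.

Lemma mpost_comul_at1_mconv (f g : Hom A) :
  mpost (comul_at A 1 1) (mconv f g) = mconv f (mpost comul g).
Proof. by rewrite /= mpost_mconv mpost1. Qed.

End ModuleConvolution.

(** * Cup products on Hom(H^n, End A) and the differentials of the deformation complex in degrees 1
    and 2 *)

Section ProductConvolution.
Variables (K : fieldType) (H : bialgType K) (A : coalgType K).
Local Notation Hom n := {linear tpow H n -> {linear A -> A}}.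

(** [cupl] and [cupr] are the outer terms of the differential, with the structure map replaced by an
    arbitrary 1-cochain. They are cup products with that cochain on the left and on the right. *)
Definition cupl m (f : Hom 1) (phi : Hom m.+1) : Hom m.+2 :=
  tlift (dmc0_first_subproof f phi).

Definition cupr m (phi : Hom m.+1) (f : Hom 1) : Hom m.+2 :=
  tlift (dmc0_last_subproof f phi) \ol tsplit H m.

Lemma cuplE m (f : Hom 1) (phi : Hom m.+1) (x : H) (u : tpow H m.+1) :
  @cupl m f phi (x \ot u) = f x \ol phi u.
Proof. exact: tliftE. Qed.

Lemma cupl_bilin m : is_bilinear (@cupl m).
Proof.
split=> [phi|f] c g g'; apply: tensor_linear_ext => x u;
  rewrite linear_mapD linear_mapZ !cuplE.
  by rewrite linear_mapD linear_mapZ (lcomp_bilin _ _ _).1.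
by rewrite linear_mapD linear_mapZ (lcomp_bilin _ _ _).2.
Qed.

Lemma cupr_bilin m : is_bilinear (@cupr m).
Proof.
have lastE (phi : Hom m.+1) (f : Hom 1) u x :
    tlift (dmc0_last_subproof f phi) (u \ot x) = phi u \ol f x.
  exact: tliftE.
have last_bilin : is_bilinear (fun (phi : Hom m.+1) (f : Hom 1) =>
    tlift (dmc0_last_subproof f phi)).
  split=> [f|phi] c g g'; apply: tensor_linear_ext => u x;
    rewrite linear_mapD linear_mapZ !lastE.
    by rewrite linear_mapD linear_mapZ (lcomp_bilin _ _ _).1.
  by rewrite linear_mapD linear_mapZ (lcomp_bilin _ _ _).2.
split=> [f|phi] c g g'; rewrite /cupr.
  by rewrite last_bilin.1 (lcomp_bilin _ _ _).1.
by rewrite last_bilin.2 (lcomp_bilin _ _ _).1.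
Qed.

Lemma cupr0 (f g : Hom 1) : @cupr 0 f g = @cupl 0 f g.
Proof.
by apply: tensor_linear_ext => x y; rewrite lcompE [LHS]tliftE cuplE.
Qed.

Lemma tensor3_linear_ext (X : lmodType K) (f g : {linear H *t (H *t H) -> X}) :
  (forall x y z, f (x \ot (y \ot z)) = g (x \ot (y \ot z))) -> f = g.
Proof.
move=> fg; apply: tensor_linear_ext => x; apply: tensor_ind => // t u ft fu.
by rewrite (bilinDr (@tens_bilin _ _ _)) !linearD ft fu.
Qed.

Lemma cupr1E (phi : Hom 2) (f : Hom 1) (x y z : H) :
  @cupr 1 phi f (x \ot (y \ot z)) = phi (x \ot y) \ol f z.
Proof. by rewrite /cupr lcompE /= tmapE tassocVE tliftE. Qed.

Lemma mul_at0E (x y z : H) :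
  mul_at H 1 0 (x \ot (y \ot z)) = (x *b y) \ot z.
Proof. by rewrite /= tassocVE tmapE. Qed.

Lemma mul_at1E (x y z : H) :
  mul_at H 1 1 (x \ot (y \ot z)) = x \ot (y *b z).
Proof. by rewrite /= tmapE. Qed.

Lemma cuplA (f g h : Hom 1) :
  @cupr 1 (@cupl 0 f g) h = @cupl 1 f (@cupl 0 g h).
Proof.
apply: tensor3_linear_ext => x y z.
by rewrite cupr1E !cuplE lcompA.
Qed.

Lemma mul_at0_cupl (f g : Hom 1) :
  @cupl 0 f g \ol mul_at H 1 0 = @cupr 1 (f \ol bmul) g.
Proof.
by apply: tensor3_linear_ext => x y z; rewrite lcompE mul_at0E cupr1E cuplE.
Qed.

Lemma mul_at1_cupl (f g : Hom 1) :
  @cupl 0 f g \ol mul_at H 1 1 = @cupl 1 f (g \ol bmul).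
Proof.
by apply: tensor3_linear_ext => x y z; rewrite lcompE mul_at1E !cuplE.
Qed.

Lemma mul_at_bmul (f : Hom 1) :
  (f \ol bmul) \ol mul_at H 1 0 = (f \ol bmul) \ol mul_at H 1 1.
Proof.
apply: tensor3_linear_ext => x y z.
by rewrite lcompE [RHS]lcompE mul_at0E mul_at1E !lcompE /bprod bmulA.
Qed.

Variable lam : Hom 1.

Lemma dmc1E (f : Hom 1) : dmc lam 1 f =
  (@cupl 0 lam f - f \ol bmul + @cupl 0 f lam,
   mconv lam f - mpost comul f + mconv f lam).
Proof.
rewrite /= /dmc0 /dmc1 !big_ord1 /= expr1 !scaleN1r sqrrN expr1n !scale1r.
by rewrite mpost1 -(cupr0 f).
Qed.

Lemma dmc2E (G : Fmc H A 2) : dmc lam 2 G =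
  (@cupl 1 lam G.1 - G.1 \ol mul_at H 1 0 + G.1 \ol mul_at H 1 1
     - @cupr 1 G.1 lam,
   mconv lam G.2 - mpost (comul_at A 1 0) G.2 + mpost (comul_at A 1 1) G.2
     - mpost (tassoc A A A) (mconv G.2 lam)).
Proof.
rewrite /= /dmc0 /dmc1 !big_ord_recl !big_ord0 !addr0 -(signr_odd _ 3) !expr1.
rewrite !scaleN1r sqrrN expr1n !scale1r !addrA.
by rewrite tjoin1.
Qed.

End ProductConvolution.

(** * The three curvatures: multiplicative, comultiplicative, and for automorphisms *)

Definition set_coef (T : Type) (f : nat -> T) n v i := if i == n then v else f i.

Lemma set_coef_low (T : Type) (f : nat -> T) n v i :
  (i < n)%N -> set_coef f n v i = f i.
Proof. by rewrite /set_coef => lt_in; rewrite ltn_eqF. Qed.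

Lemma set_coefE (T : Type) (f : nat -> T) n v : set_coef f n v n = v.
Proof. by rewrite /set_coef eqxx. Qed.

Section SeriesCurvature.
Variables (K : fieldType) (H : bialgType K) (A : coalgType K).
Local Notation EndA := {linear A -> A}.
Local Notation HEnd := {linear H -> EndA}.
Implicit Types (lam u : HEnd) (L : nat -> HEnd).
Implicit Types (Phi Psi : nat -> EndA).

Definition mul_curvature L :=
  curvature (@cupl K H A 0) (fun f : HEnd => f \ol bmul) L.

Definition comul_curvature L :=
  curvature (@mconv K H A A A) (mpost (H := H) comul) L.

Definition aut_curvature Phi :=
  curvature (@aconv K A A A) (lcomp comul) Phi.

Lemma mul_curvatureE L n x y :
  mul_curvature L n (x \ot y)
    = L n (x *b y) - pmul (@lcomp K A A A) (L^~ x) (L^~ y) n.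
Proof.
rewrite /mul_curvature /curvature linear_mapD linear_mapN lcompE /pmul linear_map_sum.
by congr (_ - _); apply: eq_bigr => i _; rewrite cuplE.
Qed.

Lemma comul_curvatureE L n x a :
  comul_curvature L n x a = comul (L n x a) -
    \tsum_(x1, x2 <- comul x) \tsum_(a1, a2 <- comul a)
      pmul (@tens K A A) (fun i => L i x1 a1) (fun i => L i x2 a2) n.
Proof.
rewrite /comul_curvature /curvature linear_mapB2 mpostE lcompE.
rewrite /pmul linear_map_sum linear_map_sum.
congr (_ - _); rewrite -tsum_sum; apply: eq_tsum => x1 x2.
by rewrite -tsum_sum.
Qed.

Lemma aut_curvatureE Phi n :
  aut_curvature Phi n
    = comul \ol Phi n - pmul (@tmap K A A A A) Phi Phi n \ol comul.
Proof.
rewrite /aut_curvature /curvature; congr (_ - _).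
by rewrite (bilin_suml (@lcomp_bilin _ _ _ _)).
Qed.

Lemma deformationP lam L :
  is_deformation lam L <->
  L 0 = lam /\ forall n, mul_curvature L n = 0 /\ comul_curvature L n = 0.
Proof.
split=> [[L0 Lmul Lcomul]|[L0 flat]]; split=> //.
- move=> n; split.
    by apply: tensor_linear_ext => x y; rewrite mul_curvatureE Lmul subrr.
  apply: linear_mapP => x; apply: linear_mapP => a.
  by rewrite comul_curvatureE Lcomul subrr.
- move=> x y n; apply/eqP; rewrite -subr_eq0 -mul_curvatureE.
  by rewrite (flat n).1.
move=> x a n; apply/eqP; rewrite -subr_eq0 -comul_curvatureE.
by rewrite (flat n).2.
Qed.

Lemma mul_curvature_cocycle L n :
  (forall i, (i < n)%N -> mul_curvature L i = 0) ->
  @cupl _ _ _ 1 (L 0) (mul_curvature L n) - mul_curvature L n \ol mul_at H 1 0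
    + mul_curvature L n \ol mul_at H 1 1 - @cupr _ _ _ 1 (mul_curvature L n) (L 0)
  = 0.
Proof.
have lin_pre m n' (g : {linear tpow H m -> tpow H n'}) :
    linear (fun f : {linear tpow H n' -> EndA} => f \ol g).
  exact: (lcomp_bilin _ _ _).1.
exact: (@curvature_cocycle _ _ _ _ _ _ _ _ _ _ (@cupl_bilin K H A 0)
  (@cupl_bilin K H A 1) (@cupr_bilin K H A 1) (lin_pre _ _ _) (lin_pre _ _ _)
  (@cuplA K H A) (@mul_at0_cupl K H A) (@mul_at1_cupl K H A)
  (@mul_at_bmul K H A) L n).
Qed.

Lemma comul_curvature_cocycle L n :
  (forall i, (i < n)%N -> comul_curvature L i = 0) ->
  mconv (L 0) (comul_curvature L n) - mpost (comul_at A 1 0) (comul_curvature L n)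
    + mpost (comul_at A 1 1) (comul_curvature L n)
    - mpost (tassoc A A A) (mconv (comul_curvature L n) (L 0))
  = 0.
Proof.
(* The right product must include the associator: convolving on the right gives a left-nested
   tensor, whereas [tpow] is right-nested. *)
have conv_bilin : is_bilinear (fun (G : {linear H -> {linear A -> A *t A}}) f =>
    mpost (tassoc A A A) (mconv G f)).
  split=> [f|G] c G' G''.
    by rewrite (mconv_bilin _ _ _ _).1 mpost_linear.
  by rewrite (mconv_bilin _ _ _ _).2 mpost_linear.
exact: (@curvature_cocycle _ _ _ _ _ _ _ _ _ _ (@mconv_bilin K H A A A)
  (@mconv_bilin K H A _ _) conv_bilin (mpost_linear _) (mpost_linear _)
  (@mconvA K H A A A A) (@mpost_comul_at0_mconv K H A)
  (@mpost_comul_at1_mconv K H A) (@mpost_comul_at_comul K H A) L n).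
Qed.

Lemma aut_curvature_cocycle Phi n :
  (forall i, (i < n)%N -> aut_curvature Phi i = 0) ->
  aconv (Phi 0) (aut_curvature Phi n) - comul_at A 1 0 \ol aut_curvature Phi n
    + comul_at A 1 1 \ol aut_curvature Phi n
    - tassoc A A A \ol aconv (aut_curvature Phi n) (Phi 0)
  = 0.
Proof.
have conv_bilin : is_bilinear (fun (G : {linear A -> A *t A}) (f : EndA) =>
    tassoc A A A \ol aconv G f).
  split=> [f|G] c G' G''.
    by rewrite (aconv_bilin _ _ _).1 (lcomp_bilin _ _ _).2.
  by rewrite (aconv_bilin _ _ _).2 (lcomp_bilin _ _ _).2.
have lin_post (V W : lmodType K) (g : {linear V -> W}) :
  linear (fun f : {linear A -> V} => g \ol f) by exact: (lcomp_bilin _ _ _).2.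
exact: (@curvature_cocycle _ _ _ _ _ _ _ _ _ _ (@aconv_bilin K A A A)
  (@aconv_bilin K A _ _) conv_bilin (lin_post _ _ _) (lin_post _ _ _)
  (@aconvA K A A A A) (@comul_at0_aconv K A)
  (@comul_at1_aconv K A) (@comul_at_comul K A) Phi n).
Qed.

End SeriesCurvature.

(** * Infinitesimals are cocycles, and integration of cocycles *)

Section Integration.
Variables (K : fieldType) (H : bialgType K) (A : coalgType K).
Local Notation EndA := {linear A -> A}.
Local Notation HEnd := {linear H -> EndA}.
Implicit Types (lam u : HEnd) (L : nat -> HEnd).
Implicit Types (Phi Psi : nat -> EndA).

(** The single change of coefficient affects both curvatures at once. This matches the differential
    out of degree 1, which feeds one cochain to both components, so one primitive can cancel both
    obstructions. *)
Lemma curvature_update_dmc L L' n :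
  (forall i, (i <= n)%N -> L' i = L i) ->
  (mul_curvature L' n.+1, comul_curvature L' n.+1) =
  (mul_curvature L n.+1, comul_curvature L n.+1)
    - dmc (L 0) 1 (L' n.+1 - L n.+1) :> Fmc H A 2.
Proof.
move=> LL'; rewrite dmc1E; congr (_, _).
  apply: (curvature_update (@cupl_bilin K H A 0)) LL'.
  exact: (lcomp_bilin _ _ _).1.
exact: (curvature_update (@mconv_bilin K H A A A) (mpost_linear _)) LL'.
Qed.

Lemma curvature_dmc_cocycle L n :
  (forall i, (i < n)%N -> mul_curvature L i = 0 /\ comul_curvature L i = 0) ->
  is_cocycle (dmc (L 0)) 2 (mul_curvature L n, comul_curvature L n).
Proof.
move=> flat; rewrite /is_cocycle dmc2E /=.
rewrite mul_curvature_cocycle; last by move=> i /flat [].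
by rewrite comul_curvature_cocycle // => i /flat [].
Qed.

Lemma Fmc2_eq0 (F : {linear tpow H 2 -> EndA})
    (G : {linear H -> {linear A -> tpow A 2}}) :
  (F, G) = 0 :> Fmc H A 2 -> F = 0 /\ G = 0.
Proof.
by move=> FG0; split; [apply: (congr1 fst FG0) | apply: (congr1 snd FG0)].
Qed.

Lemma curvature1_dmc L :
  (mul_curvature L 1, comul_curvature L 1) = - dmc (L 0) 1 (L 1%N) :> Fmc H A 2.
Proof. by rewrite dmc1E; congr (_, _); apply: curvature1. Qed.

(** Up to sign, the coboundary of [L 1] is the degree 1 curvature, which vanishes for a
    deformation. *)
Lemma infinitesimal_cocycle lam L :
  is_deformation lam L -> is_cocycle (dmc lam) 1 (L 1%N).
Proof.
move=> /deformationP [<- flat]; rewrite /is_cocycle -[dmc _ _ _]opprK.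
by rewrite -curvature1_dmc (flat 1%N).1 (flat 1%N).2 oppr0.
Qed.

Lemma flat_pconst lam n : is_module_coalgebra lam ->
  mul_curvature (pconst lam) n = 0 /\ comul_curvature (pconst lam) n = 0.
Proof.
move=> [lam_mul lam_comul].
suff /deformationP [] : is_deformation lam (pconst lam) by [].
split=> // [x y k|x a k].
  (* Evaluating [pconst lam] at [x] agrees with [pconst (lam x)] only after case analysis on the
     degree, so the series are exchanged coefficientwise. *)
  rewrite -[RHS](@eq_pmul_low _ _ _ _ (@lcomp K A A A) (pconst (lam x)) _
    (pconst (lam y))).
  - rewrite pmul_constl; last exact: lcomp_bilin.
    by case: k => [|k]; rewrite /= ?lam_mul // bilin0r //; apply: lcomp_bilin.
  - by case.
  - by case.
transitivity (pconst (comul (lam x a)) k).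
  by case: k => //= k; rewrite linear0.
transitivity (\tsum_(x1, x2 <- comul x) \tsum_(a1, a2 <- comul a)
    pconst (lam x1 a1 \ot lam x2 a2) k).
  case: k => [|k] /=; first exact: lam_comul.
  rewrite tsum.unlock /free_ext big1 // => p _.
  by rewrite big1 ?scaler0 // => q _; rewrite scaler0.
apply: eq_tsum => x1 x2; apply: eq_tsum => a1 a2.
rewrite -[RHS](@eq_pmul_low _ _ _ _ (@tens K A A) (pconst (lam x1 a1)) _
  (pconst (lam x2 a2))).
- rewrite pmul_constl; last exact: tens_bilin.
  by case: k => [|k] //=; rewrite bilin0r //; apply: tens_bilin.
- by case.
- by case.
Qed.

Lemma cocycle_integrable lam : is_module_coalgebra lam ->
  trivial_cohomology (dmc lam) 2 ->
  forall z : Fmc H A 1, is_cocycle (dmc lam) 1 z ->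
    exists L, is_deformation lam L /\ L 1%N = z.
Proof.
move=> lamP H2_0 z z_cocycle.
(* The offset 1 freezes both [lam] and [z]: at stage n the series is flat through degree n+1, and
   the next correction is in degree n+2. *)
pose P n L := L 0 = lam /\ forall i, (i <= n + 1)%N ->
  mul_curvature L i = 0 /\ comul_curvature L i = 0.
pose L0 := set_coef (pconst lam) 1 z.
have [|||L L_low L_flat] := @series_by_approximation _ 1 P L0.
- move=> n f g fg [f0 flat]; split=> [|i le_in]; first by rewrite -fg.
  have fg' j : (j <= i)%N -> f j = g j by move=> /leq_trans /(_ le_in); apply: fg.
  by rewrite /mul_curvature /comul_curvature -!(eq_curvature _ _ fg'); apply: flat.
- split=> // -[_|[_|//]].
    have L0E i : (i <= 0)%N -> L0 i = pconst lam i by case: i.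
    rewrite /mul_curvature /comul_curvature !(eq_curvature _ _ L0E).
    exact: flat_pconst.
  have := curvature1_dmc L0; rewrite [dmc _ _ _]z_cocycle oppr0.
  exact: Fmc2_eq0.
- move=> n f [f0 flat].
  have {}flat i : (i < n.+2)%N ->
    mul_curvature f i = 0 /\ comul_curvature f i = 0.
    by rewrite ltnS -[n.+1]addn1; apply: flat.
  (* The obstruction pair in degree n+2 is the coboundary of [u]. Adding [u] to the coefficient
     subtracts exactly that pair. *)
  have := curvature_dmc_cocycle flat; rewrite f0 => /H2_0 [u uE].
  pose g := set_coef f n.+2 (f n.+2 + u).
  have gf i : (i <= n.+1)%N -> g i = f i by rewrite -ltnS; apply: set_coef_low.
  exists g => [i|]; first by rewrite addn1; apply: gf.
  split=> [|i]; first by rewrite gf.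
  rewrite addn1 leq_eqVlt => /predU1P [->|lt_in]; last first.
    have gf' j : (j <= i)%N -> g j = f j by move=> /leq_trans /(_ lt_in); apply: gf.
    by rewrite /mul_curvature /comul_curvature !(eq_curvature _ _ gf'); apply: flat.
  have := curvature_update_dmc gf; rewrite uE f0 /g set_coefE addrAC subrr add0r subrr.
  exact: Fmc2_eq0.
exists L; split; last by rewrite L_low.
apply/deformationP; split=> [|n]; first by rewrite L_low.
by apply: (L_flat n).2; rewrite leq_addr.
Qed.

End Integration.

(** * Equivalence of deformations and rigidity *)

Section Equivalence.
Variables (K : fieldType) (H : bialgType K) (A : coalgType K).
Local Notation EndA := {linear A -> A}.
Local Notation HEnd := {linear H -> EndA}.
Implicit Types (lam u : HEnd) (L : nat -> HEnd).
Implicit Types (Phi Psi : nat -> EndA).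
Local Notation comp_series := (pmul (@lcomp K A A A)).

Lemma coder_dc (f : EndA) : f \in @coder_pred K A -> dc A 1 f = 0.
Proof.
move=> /asboolP f_coder; rewrite dc1E f_coder (bilinDl (@lcomp_bilin _ _ _ _)).
by rewrite opprD addrA subrr add0r addNr.
Qed.

(** In degree 1, comultiplicativity of [Phi] makes [Phi 1] a coderivation and the inverse has
    coefficient [- Phi 1]. Expanding the conjugation to first order leaves the coboundary of
    [Phi 1]. *)
Lemma equivalent_cohomologous lam L L' :
  is_deformation lam L -> equivalent_deformations L L' ->
  cohomologous (dmc lam) 1 (L' 1%N) (L 1%N).
Proof.
move=> [L0 _ _] [Phi [Psi [[Phi0 Phi_comul] [PhiPsi _] L'E]]].
have Psi0 : Psi 0 = lid A.
  by have := PhiPsi 0; rewrite pmul0 Phi0 lcomp1f.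
have Psi1 : Psi 1%N = - Phi 1%N.
  have := PhiPsi 1%N; rewrite pmul1 Phi0 Psi0 lcomp1f lcompf1 => /eqP.
  by rewrite addr_eq0 => /eqP.
have Phi1_coder : Phi 1%N \in @coder_pred K A.
  apply/asboolP; rewrite /is_coderivation Phi_comul pmul1.
  by rewrite Phi0.
exists (Coder Phi1_coder); apply: linear_mapP => x.
rewrite linear_mapB L'E pmul1 pmul1 pmul0 Phi0 Psi0 Psi1 L0 !lcomp1f lcompf1.
rewrite -addrA (addrAC (L 1%N x)) subrr add0r.
by rewrite (bilinNl (@lcomp_bilin _ _ _ _)).
Qed.

Lemma series_right_inverse Phi : Phi 0 = lid A ->
  exists2 Psi, Psi 0 = lid A & comp_series Phi Psi =1 pconst (lid A).
Proof.
move=> Phi0; have compb := @lcomp_bilin K A A A.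
pose P n Psi := forall i, (i <= n + 0)%N -> comp_series Phi Psi i = pconst (lid A) i.
have [|||Psi Psi_low PsiP] := @series_by_approximation _ 0 P (pconst (lid A)).
- move=> n f g fg Pf i le_in; rewrite -Pf //; apply: eq_pmul_low => // j le_ji.
  by rewrite fg // (leq_trans le_ji).
- by case=> // _; rewrite pmul0 Phi0 lcomp1f.
- move=> n f Pf; pose g := set_coef f n.+1 (f n.+1 - comp_series Phi f n.+1).
  have gf i : (i <= n)%N -> g i = f i by rewrite -ltnS; apply: set_coef_low.
  exists g => [i|i]; first by rewrite addn0; apply: gf.
  rewrite addn0 leq_eqVlt => /predU1P [->|le_in]; last first.
    rewrite -Pf ?addn0 //; apply: eq_pmul_low => // j le_ji.
    by rewrite gf // (leq_trans le_ji).
  rewrite (pmul_update compb (fun i _ => erefl (Phi i)) gf) subrr bilin0l //.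
  by rewrite addr0 Phi0 lcomp1f /g set_coefE addrAC subrr add0r subrr.
exists Psi => [|n]; first by rewrite Psi_low.
by apply: (PsiP n); rewrite addn0.
Qed.

(** The right inverse [Psi] has a right inverse [Phi'] of its own, and Phi = Phi (Psi Phi') = (Phi
    Psi) Phi' = Phi', so [Psi] is two-sided. *)
Lemma series_inverse_exists Phi : Phi 0 = lid A ->
  exists Psi, is_series_inverse Phi Psi.
Proof.
move=> /series_right_inverse [Psi Psi0 PhiPsi]; exists Psi; split=> // n.
have compb := @lcomp_bilin K A A A.
have [Phi' _ PsiPhi'] := series_right_inverse Psi0.
rewrite -PsiPhi'; apply: eq_pmul_low => // i _.
transitivity (comp_series Phi (comp_series Psi Phi') i).
  by rewrite (eq_pmul_low _ (fun j _ => erefl (Phi j)) (fun j _ => PsiPhi' j))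
             pmul_constr // lcompf1.
rewrite -(pmulA _ _ _ _ compb compb compb compb (fun x y z => esym (lcompA x y z))).
rewrite (eq_pmul_low _ (fun j _ => PhiPsi j) (fun j _ => erefl (Phi' j))).
by rewrite pmul_constl // lcomp1f.
Qed.

(** The failure of [Phi] to intertwine the constant series [lam] with [L], written without the
    inverse of [Phi]. *)
Definition defect lam L Phi n : HEnd :=
  pmul (@mpre K H A A) L Phi n - mpost (Phi n) lam.

Lemma defectE lam L Phi n x :
  defect lam L Phi n x = comp_series (L^~ x) Phi n - Phi n \ol lam x.
Proof.
by rewrite /defect linear_mapB mpostE /pmul linear_map_sum.
Qed.

Lemma pmul_mpreE (V : lmodType K) (G : nat -> {linear H -> {linear A -> V}})
    Phi n x :
  pmul (@mpre K H A V) G Phi n x = pmul (@lcomp K A A V) (G^~ x) Phi n.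
Proof. by rewrite /pmul linear_map_sum. Qed.

Lemma pmul_mconvE L L' n x :
  pmul (@mconv K H A A A) L L' n x
    = \tsum_(x1, x2 <- comul x) pmul (@aconv K A A A) (L^~ x1) (L'^~ x2) n.
Proof.
rewrite /pmul linear_map_sum tsum_sum.
by apply: eq_bigr => i _; rewrite mconvE.
Qed.

(** Precomposition with a coalgebra map respects convolution. The interchange law moves both copies
    of [Phi] next to the comultiplication, where flatness through degree n merges them into one. *)
Lemma pmul_aconv_lcomp (f g : nat -> EndA) Phi n :
  (forall i, (i <= n)%N -> aut_curvature Phi i = 0) ->
  pmul (@aconv K A A A) (comp_series f Phi) (comp_series g Phi) n
    = pmul (@lcomp K A A _) (pmul (@aconv K A A A) f g) Phi n.
Proof.
move=> Phi_flat.
have aconvE (F G : nat -> EndA) k :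
    pmul (@aconv K A A A) F G k = pmul (@tmap K A A A A) F G k \ol comul.
  by rewrite [RHS](bilin_suml (@lcomp_bilin _ _ _ _)).
rewrite aconvE.
rewrite -(pmulACA _ _ _ _ _ (@lcomp_bilin _ _ _ _) (@tmap_bilin _ _ _ _ _)
  (@tmap_bilin _ _ _ _ _) (@tmap_bilin _ _ _ _ _) (@lcomp_bilin _ _ _ _)
  (@lcomp_bilin _ _ _ _) (fun x y z t => esym (tmap_comp x y z t))).
rewrite [LHS](bilin_suml (@lcomp_bilin _ _ _ _)); apply: eq_bigr => i _.
rewrite aconvE -!lcompA; congr (_ \ol _).
apply/eqP; rewrite eq_sym -subr_eq0 -aut_curvatureE Phi_flat //.
exact: leq_subr.
Qed.

Lemma pmul_mconv_mpre L L' Phi n :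
  (forall i, (i <= n)%N -> aut_curvature Phi i = 0) ->
  pmul (@mconv K H A A A) (pmul (@mpre K H A A) L Phi)
    (pmul (@mpre K H A A) L' Phi) n
  = pmul (@mpre K H A _) (pmul (@mconv K H A A A) L L') Phi n.
Proof.
move=> Phi_flat; apply: linear_mapP => x; rewrite pmul_mconvE pmul_mpreE.
transitivity (\tsum_(x1, x2 <- comul x)
    pmul (@lcomp K A A _) (pmul (@aconv K A A A) (L^~ x1) (L'^~ x2)) Phi n).
  apply: eq_tsum => x1 x2; rewrite -pmul_aconv_lcomp //.
  by apply: eq_pmul_low => i _; rewrite pmul_mpreE.
rewrite /pmul tsum_sum; apply: eq_bigr => i _; rewrite [X in X \ol _]pmul_mconvE.
by rewrite [RHS](tsum_map (lin ((@lcomp_bilin _ _ _ _).1 _))).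
Qed.

Section DefectCocycle.
Variables (lam : HEnd) (L : nat -> HEnd) (Phi : nat -> EndA) (n : nat).
Hypothesis lamP : is_module_coalgebra lam.
Hypothesis LP : is_deformation lam L.
Hypothesis Phi0 : Phi 0 = lid A.
Hypothesis Phi_flat : forall i, (i <= n)%N -> aut_curvature Phi i = 0.
Hypothesis Phi_defect : forall i, (i < n)%N -> defect lam L Phi i = 0.

(** This is degree n of L(x)(L(y) Phi - Phi lam(y)) - (L(xy) Phi - Phi lam(xy)) + (L(x) Phi - Phi
    lam(x)) lam(y), which cancels because [L] and [lam] are multiplicative. *)
Lemma defect_mul x y :
  lam x \ol defect lam L Phi n y - defect lam L Phi n (x *b y)
    + defect lam L Phi n x \ol lam y = 0.
Proof.
have compb V := @lcomp_bilin K A A V.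
have -> : lam x \ol defect lam L Phi n y =
    comp_series (L^~ (x *b y)) Phi n - comp_series (L^~ x) Phi n \ol lam y.
  (* As the defect vanishes below n, composing its leading coefficient with [L 0] is the degree n
     coefficient of the product of the full series. *)
  rewrite -(deformation0 LP) -(pmul_lowr (compb A) (L^~ x)
    (g := fun i => defect (L 0) L Phi i y)); last first.
    by move=> i lt_in; rewrite (deformation0 LP) Phi_defect.
  rewrite (deformation0 LP).
  rewrite (eq_pmul_low _ (fun i _ => erefl (L i x))
    (fun i _ => defectE lam L Phi i y)).
  rewrite pmulBr //; congr (_ - _).
    rewrite -(pmulA _ _ _ _ (compb A) (compb A) (compb A) (compb A)
      (fun f g h => esym (lcompA f g h))).
    by apply: eq_pmul_low => // i _; rewrite (deformation_mul LP).
  rewrite /pmul (bilin_suml (compb A)).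
  by apply: eq_bigr => i _; rewrite lcompA.
rewrite !defectE (module_mul lamP) (bilinBl (compb A)) -lcompA.
by rewrite opprB addrAC subrKA subrKA subrr.
Qed.

(** Write X = L Phi and Y = Phi lam, both comultiplicative in degree n. Then Y * (X - Y) + (X - Y) *
    X = X * X - Y * Y is the comultiplication applied to X - Y. Since X and Y start with [lam], the
    lowest order of this identity is the claim. *)
Lemma defect_comul :
  mconv lam (defect lam L Phi n) - mpost comul (defect lam L Phi n)
    + mconv (defect lam L Phi n) lam = 0.
Proof.
pose LPhi := pmul (@mpre K H A A) L Phi.
pose Philam i := mpost (Phi i) lam.
have LPhi0 : LPhi 0 = lam.
  apply: linear_mapP => x.
  by rewrite pmul_mpreE pmul0 Phi0 lcompf1 (deformation0 LP).
have Philam0 : Philam 0 = lam by rewrite /Philam Phi0 mpost1.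
have LPhi_comul : pmul (@mconv K H A A A) LPhi LPhi n = mpost comul (LPhi n).
  rewrite pmul_mconv_mpre //; apply: linear_mapP => x.
  rewrite mpostE !pmul_mpreE [RHS](bilin_sumr (@lcomp_bilin _ _ _ _)).
  apply: eq_bigr => i _; rewrite lcompA; congr (_ \ol _).
  have [_ flat] := (deformationP lam L).1 LP.
  have /(congr1 (fun f : {linear H -> {linear A -> A *t A}} => f x)) := (flat i).2.
  by rewrite linear_mapB => /eqP; rewrite subr_eq0 => /eqP.
have Philam_comul :
    pmul (@mconv K H A A A) Philam Philam n = mpost comul (Philam n).
  transitivity (mpost (comul \ol Phi n) lam); last exact: mpost_comp.
  have -> : comul \ol Phi n = pmul (@tmap K A A A A) Phi Phi n \ol comul.
    by apply/eqP; rewrite -subr_eq0 -aut_curvatureE Phi_flat.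
  rewrite mpost_comp.
  have -> : mpost comul lam = mconv lam lam.
    have [_ /eqP] := flat_pconst 0 lamP.
    by rewrite /comul_curvature /curvature pmul0 subr_eq0 => /eqP.
  rewrite [RHS](bilin_suml (@mpost_bilin K H A _ _)).
  by apply: eq_bigr => i _; rewrite mpost_mconv.
have -> : mconv lam (defect lam L Phi n)
    = pmul (@mconv K H A A A) Philam (defect lam L Phi) n.
  by rewrite (pmul_lowr (@mconv_bilin _ _ _ _ _) _ Phi_defect) Philam0.
have -> : mconv (defect lam L Phi n) lam
    = pmul (@mconv K H A A A) (defect lam L Phi) LPhi n.
  by rewrite (pmul_lowl (@mconv_bilin _ _ _ _ _) _ Phi_defect) LPhi0.
rewrite [X in X - _ + _](pmulBr (@mconv_bilin _ _ _ _ _)).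
rewrite [X in _ + X](pmulBl (@mconv_bilin _ _ _ _ _)).
rewrite Philam_comul LPhi_comul.
rewrite [X in _ - X + _](bilinBr (@mpost_bilin _ _ _ _ _)) -/LPhi.
by rewrite opprB subrKA subrKA subrr.
Qed.

Lemma defect_cocycle : is_cocycle (dmc lam) 1 (defect lam L Phi n).
Proof.
rewrite /is_cocycle dmc1E defect_comul; congr (_, _).
apply: tensor_linear_ext => x y; rewrite -[RHS](defect_mul x y).
rewrite linear_mapD linear_mapB !cuplE lcompE; congr (_ - _ + _).
Qed.

End DefectCocycle.

Lemma rigidity lam : is_module_coalgebra lam ->
  trivial_cohomology (dc A) 2 -> trivial_cohomology (dmc lam) 1 -> rigid lam.
Proof.
move=> lamP Hc2_0 H1_0 L LP; have compb V := @lcomp_bilin K A A V.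
pose P n Phi := Phi 0 = lid A /\ forall i, (i <= n + 0)%N ->
  aut_curvature Phi i = 0 /\ defect lam L Phi i = 0.
have eq_defect f g i : (forall j, (j <= i)%N -> f j = g j) ->
    defect lam L f i = defect lam L g i.
  move=> fg; rewrite /defect fg //; congr (_ - _).
  exact: eq_pmul_low.
have [|||Phi Phi_low PhiP] := @series_by_approximation _ 0 P (pconst (lid A)).
- move=> n f g fg [f0 flat]; split=> [|i le_in]; first by rewrite -fg.
  have fg' j : (j <= i)%N -> f j = g j by move=> /leq_trans /(_ le_in); apply: fg.
  rewrite -(eq_defect _ _ _ fg') /aut_curvature -(eq_curvature _ _ fg').
  exact: flat.
- split=> // -[_|//]; split.
    by rewrite aut_curvatureE pmul0 /= tmap1 lcomp1f lcompf1 subrr.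
  apply: linear_mapP => x; rewrite defectE pmul0 lcomp1f lcompf1.
  by rewrite (deformation0 LP) subrr.
- move=> n f [f0 flat].
  have {}flat i : (i < n.+1)%N -> aut_curvature f i = 0 /\ defect lam L f i = 0.
    by rewrite ltnS -[n in (_ <= n)%N]addn0; apply: flat.
  (* First correction: [w] makes the series comultiplicative in degree n+1, with no control yet over
     the defect there. *)
  have /Hc2_0 [w wE] : is_cocycle (dc A) 2 (aut_curvature f n.+1).
    rewrite /is_cocycle dc2E -f0.
    by apply: aut_curvature_cocycle => i /flat [].
  pose f' := set_coef f n.+1 (f n.+1 + w).
  have f'f i : (i <= n)%N -> f' i = f i by rewrite -ltnS; apply: set_coef_low.
  have update g g' : g 0 = lid A -> (forall i, (i <= n)%N -> g' i = g i) ->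
      aut_curvature g' n.+1 = aut_curvature g n.+1 - dc A 1 (g' n.+1 - g n.+1).
    move=> g0 g'g; rewrite dc1E -g0.
    exact: (curvature_update (@aconv_bilin K A A A) ((@lcomp_bilin _ _ _ _).2 _)).
  have f'0 : f' 0 = lid A by rewrite f'f.
  have f'_low i : (i < n.+1)%N -> aut_curvature f' i = 0 /\ defect lam L f' i = 0.
    move=> lt_in; have f'f' j : (j <= i)%N -> f' j = f j.
      by move=> le_ji; rewrite f'f // (leq_trans le_ji).
    rewrite (eq_defect _ _ _ f'f') /aut_curvature (eq_curvature _ _ f'f').
    exact: flat.
  have f'_flat i : (i <= n.+1)%N -> aut_curvature f' i = 0.
    rewrite leq_eqVlt => /predU1P [->|/f'_low [] //].
    rewrite (update f f') // wE /f' set_coefE (addrC (f _)) addrK.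
    exact: subrr.
  have f'_defect i : (i < n.+1)%N -> defect lam L f' i = 0 by move=> /f'_low [].
  have [y yE] := H1_0 _ (defect_cocycle lamP LP f'0 f'_flat f'_defect).
  (* Second correction: subtracting [y] lowers the defect in degree n+1 by the coboundary of [y].
     Being a coderivation, [y] is a cocycle for [dc], so comultiplicativity survives. *)
  pose g := set_coef f' n.+1 (f' n.+1 - coder_val y).
  have gf' i : (i <= n)%N -> g i = f' i by rewrite -ltnS; apply: set_coef_low.
  have gE : g n.+1 - f' n.+1 = - coder_val y.
    by rewrite /g set_coefE addrAC subrr add0r.
  exists g => [i|]; first by rewrite addn0 => le_in; rewrite gf' // f'f.
  split=> [|i]; first by rewrite gf'.
  rewrite addn0 leq_eqVlt => /predU1P [->|lt_in]; last first.
    have gf'' j : (j <= i)%N -> g j = f' j.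
      by move=> le_ji; rewrite gf' // (leq_trans le_ji).
    rewrite (eq_defect _ _ _ gf'') /aut_curvature (eq_curvature _ _ gf'').
    exact: f'_low.
  split.
    rewrite (update f' g) // f'_flat // gE coder_dc ?subrr //.
    by rewrite rpredN; apply: coder_valP.
  apply: linear_mapP => x; rewrite defectE.
  rewrite (pmul_update (compb A) (fun i _ => erefl (L i x)) gf') subrr.
  rewrite (bilin0l (compb A)) addr0 gE.
  have -> : g n.+1 = f' n.+1 - coder_val y by rewrite /g set_coefE.
  have := congr1 (fun h : HEnd => h x) yE; rewrite defectE => /eqP.
  rewrite subr_eq => /eqP ->; rewrite (deformation0 LP).
  rewrite (bilinNr (compb A)) (bilinBl (compb A)).
  rewrite -[dmc lam 0 y x]/(lam x \ol coder_val y - coder_val y \ol lam x).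
  rewrite (addrAC _ _ (- (lam x \ol _))) (addrAC (lam x \ol _)) subrr add0r.
  by rewrite (addrC (- _)) subrr.
have Phi0 : Phi 0 = lid A by rewrite Phi_low.
have [Psi PsiP] := series_inverse_exists Phi0.
have flat i : aut_curvature Phi i = 0 /\ defect lam L Phi i = 0.
  by apply: (PhiP i).2; rewrite addn0.
exists Phi, Psi; split=> // [|x n].
  split=> // n; apply/eqP; rewrite -subr_eq0 -aut_curvatureE.
  by rewrite (flat n).1.
rewrite (pmulA _ _ _ _ (compb A) (compb A) (compb A) (compb A)
  (fun f g h => esym (lcompA f g h))).
(* Vanishing of the defect gives Psi (L Phi) = Psi (Phi lam) = lam. *)
transitivity (comp_series Psi Phi n \ol lam x).
  by rewrite PsiP.2; case: n => [|n]; rewrite /= ?lcomp1f ?(bilin0l (compb A)).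
rewrite [LHS](bilin_suml (compb A)); apply: eq_bigr => i _.
rewrite -lcompA; congr (_ \ol _); apply/esym/eqP.
by rewrite -subr_eq0 -defectE (flat _).2.
Qed.

End Equivalence.

Theorem mainTheorem10 (K : fieldType) (H : bialgType K) (A : coalgType K)
    (lam : {linear H -> {linear A -> A}}) (hlam : is_module_coalgebra lam) :
  (forall Lam : nat -> {linear H -> {linear A -> A}},
     is_deformation lam Lam ->
     is_cocycle (dmc lam) 1 (Lam 1%N) /\
     (forall Lam' : nat -> {linear H -> {linear A -> A}},
        is_deformation lam Lam' -> equivalent_deformations Lam Lam' ->
        cohomologous (dmc lam) 1 (Lam' 1%N) (Lam 1%N))) /\
  (trivial_cohomology (dc A) 2 -> trivial_cohomology (dmc lam) 1 ->
     rigid lam) /\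
  (trivial_cohomology (dmc lam) 2 ->
     forall z : Fmc H A 1, is_cocycle (dmc lam) 1 z ->
       exists Lam : nat -> {linear H -> {linear A -> A}},
         is_deformation lam Lam /\ Lam 1%N = z).
Proof.
split=> [L LP|]; last first.
  by split; [apply: rigidity | apply: cocycle_integrable].
split; first exact: infinitesimal_cocycle LP.
by move=> L' _; apply: equivalent_cohomologous.
Qed.
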